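(* Let $g(x)=\alpha x^{q^k}+\beta x$ with $\alpha\in\mathbb{F}_{q^n}^*$, $\beta\in\mathbb{F}_{q^n}$, $1\le k<n$, and let $f(y)=\sum_{i=0}^d a_iy^{q^i}\in\mathbb{F}_{q^n}[y]$, $0\le d<n$, $a_d\ne0$, be not a monomial. Let $0\le h<n$ with $h>\ell$. If $f$ is a binomial and $h=d$, assume moreover $a_h\ne\beta$. Define \[m_h=\begin{cases}\max\{d,h\} & \text{if } a_d\ne\beta \text{ or } d\ne h,\\ \ell_3 & \text{if } a_d=\beta \text{ and } d=h.\end{cases}\] If $k+m_h-\ell\le n/2$, then $L_g\cap L_f\ne\emptyset$.
   Context: Let $q$ be a prime power, $n\ge2$. For $f(y)=\sum_{i=0}^d a_iy^{q^i}$ with $a_d\neq0$: $\ell=\min\{i: a_i\ne0\}$; when $f$ is not a monomial (i.e. has at least two nonzero coefficients), $\ell_2=\min\{i>\ell: a_i\ne0\}$ and $\ell_3=\max\{i<d:a_i\ne0\}$; $f$ is a binomial if it has exactly two nonzero coefficients. Coefficients $a_i$ with $i$ outside the support are $0$. For an integer $0\le h<n$: $L_g=\{\langle(x,g(x))\rangle_{\mathbb{F}_{q^n}}:x\in\mathbb{F}_{q^n}^*\}$ and $L_f=\{\langle(y^{q^h},f(y))\rangle_{\mathbb{F}_{q^n}}:y\in\mathbb{F}_{q^n}^*\}$, points of $\mathrm{PG}(1,q^n)$. *)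

(* Defs.v *)
From HB Require Import structures.
From mathcomp Require Import all_boot all_order all_algebra.
Set Implicit Arguments. Unset Strict Implicit. Unset Printing Implicit Defensive.
Import GRing.Theory.
Local Open Scope ring_scope.

Definition prime_power (q : nat) : Prop :=
  exists p e : nat, prime p /\ (0 < e)%N /\ q = (p ^ e)%N.

Definition linpoly (F : fieldType) (q d : nat) (a : nat -> F) (y : F) : F :=
  \sum_(i < d.+1) a i * y ^+ (q ^ i).

Definition nsupp (F : fieldType) (d : nat) (a : nat -> F) : nat :=
  #|[set i : 'I_d.+1 | a i != 0]|.

Definition ell (F : fieldType) (d : nat) (a : nat -> F) : nat :=
  find (fun i => a i != 0) (iota 0 d.+1).

Definition ell3 (F : fieldType) (d : nat) (a : nat -> F) : nat :=
  \max_(i < d | a i != 0 :> F) (i : nat).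

Definition span1 (F : finFieldType) (v : F * F) : {set F * F} :=
  [set (c * v.1, c * v.2) | c : F].

Definition Lg (F : finFieldType) (g : F -> F) : {set {set F * F}} :=
  [set span1 (x, g x) | x in [set x : F | x != 0]].

Definition Lf (F : finFieldType) (q h : nat) (f : F -> F) : {set {set F * F}} :=
  [set span1 (y ^+ (q ^ h), f y) | y in [set y : F | y != 0]].

(* Main.v *)
(* With w(y) = (f(y) - beta y^(q^h)) / (alpha y^(q^h)), the two linear sets
   meet as soon as some y <> 0 makes w(y) a nonzero (q^k - 1)-th power, that
   is, an s-th power for s = gcd(q^k - 1, Q - 1), Q = q^n.  Replacing y^(q^l)
   by y turns the numerator into a separable linearized polynomial of degree
   at most q^(m_h - l), which is not a monomial, so the Weil bound for
   multiplicative character sums of order dividing s yields such a y when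
   (q^k q^(m_h - l))^2 <= q^n.

   The Weil bound is obtained elementarily.  A Stepanov-type auxiliary
   polynomial, exploiting that F_(Q^2u) is cut out by x^(X^2) = x with
   X = Q^u, shows that over F_(Q^2u) the sum is O(Q^u).  The L-function of the
   character is a polynomial, since the character is periodic modulo f and
   nontrivial; hence the sums over F_(Q^r) are minus the r-th power sums of
   its at most deg f - 1 reciprocal roots, and the O(Q^u) estimate forces
   these to have absolute value at most sqrt Q. *)
Require Import Defs.
From HB Require Import structures.
From mathcomp Require Import all_boot all_order all_algebra.
From mathcomp Require Import all_solvable all_field.
From mathcomp Require Import zify ring.
Set Implicit Arguments. Unset Strict Implicit. Unset Printing Implicit Defensive.
Import Order.TTheory GRing.Theory Num.Theory.
Local Open Scope ring_scope.

(** * Stepanov's method *)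

(** Stepanov's argument gives upper bounds only, and here only over fields of square order X^2.
    Neither restriction hurts: upper bounds on all s fibers together force lower bounds, and even
    extension degrees control the squares of the reciprocal roots, which determine their absolute
    values. The implied constant disappears as the degree grows.

    All extensions of F live in one algebraic closure K, as fixed points of powers of Frobenius. A
    character is a function [tau] on the s-th roots of unity of K, applied after the power (Q^i -
    1)/s, so its compatibility with norms is an identity between exponents. The Euler product is a
    count over points and their characteristic polynomials, which avoids irreducible polynomials.

    A nonzero simple root of the numerator drives the analytic part: it makes the auxiliary
    polynomial nonzero, and the resulting estimate then also proves the character nontrivial. *)

Lemma polys_dependent (K : fieldType) (N m : nat) (p : 'I_N -> {poly K}) :
  (m < N)%N -> (forall i, (size (p i) <= m)%N) ->
  exists2 e : 'I_N -> K, exists i, e i != 0 & \sum_i e i *: p i = 0.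
Proof.
move=> mN sp; pose A := \matrix_(i < N) (poly_rV (p i) : 'rV[K]_m).
have kA : kermx A != 0.
  rewrite kermx_eq0 /row_free neq_ltn; apply/orP; left.
  exact: leq_ltn_trans (rank_leq_col A) mN.
have [i ri] : exists i, row i (kermx A) != 0.
  apply/existsP; apply: contraNT kA; rewrite negb_exists => /forallP r0.
  by apply/eqP/row_matrixP => i; rewrite row0; apply/eqP; move: (r0 i); rewrite negbK.
exists (fun j => row i (kermx A) 0 j).
  apply/existsP; apply: contraNT ri; rewrite negb_exists => /forallP r0.
  by apply/eqP/rowP => j; rewrite [RHS]mxE; apply/eqP; move: (r0 j); rewrite negbK.
have r0 : row i (kermx A) *m A = 0 by rewrite -row_mul mulmx_ker row0.
transitivity (rVpoly (row i (kermx A) *m A)); last by rewrite r0 linear0.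
rewrite mulmx_sum_row linear_sum; apply: eq_bigr => j _ /=.
by rewrite linearZ /= rowK poly_rV_K.
Qed.

(** Distinct vanishing orders at [v] force independence: after division by the lowest power of
    [X - v] that occurs, evaluation at [v] leaves a single term. *)
Lemma lowest_term (K : fieldType) (N : nat) (v : K) (o : 'I_N -> nat)
    (c : 'I_N -> K) (U : 'I_N -> {poly K}) :
  {homo o : i j / (i < j)%N} -> (forall i, (U i).[v] != 0) ->
  \sum_i c i *: (('X - v%:P) ^+ o i * U i) = 0 -> forall i, c i = 0.
Proof.
move=> om Uv s0 i; apply/eqP/contraT => ci0.
pose i0 := [arg min_(j < i | c j != 0) (j : nat)].
have [ci00 mi0] : c i0 != 0 /\ forall j, c j != 0 -> (i0 <= j)%N.
  by rewrite /i0; case: arg_minnP.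
pose R := \sum_j c j *: (('X - v%:P) ^+ (o j - o i0) * U j).
have : ('X - v%:P) ^+ o i0 * R = 0.
  rewrite -s0 /R mulr_sumr; apply: eq_bigr => j _.
  have [->|cj] := eqVneq (c j) 0; first by rewrite !scale0r mulr0.
  rewrite -scalerAr mulrA -exprD subnKC //.
  have := mi0 _ cj; rewrite leq_eqVlt => /orP [/eqP/val_inj -> //|/om/ltnW //].
move/eqP; rewrite mulf_eq0 expf_eq0 polyXsubC_eq0 andbF /= => /eqP R0.
have : R.[v] = 0 by rewrite R0 horner0.
rewrite /R horner_sum (bigD1 i0) //= subnn expr0 mul1r hornerZ big1 ?addr0.
  by move/eqP; rewrite mulf_eq0 (negPf ci00) (negPf (Uv _)).
move=> j ji0; have [->|cj] := eqVneq (c j) 0; first by rewrite scale0r horner0.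
have /om lt : (i0 < j)%N by rewrite ltn_neqAle mi0 // eq_sym -val_eqE in ji0 *; rewrite ji0.
by rewrite hornerZ hornerM horner_exp hornerXsubC subrr expr0n subn_eq0 leqNgt lt /= mul0r mulr0.
Qed.

Lemma size_exp_leq (K : fieldType) (p : {poly K}) (G n : nat) :
  (size p <= G.+1)%N -> (size (p ^+ n) <= (G * n).+1)%N.
Proof.
move=> sp; apply: leq_trans (size_poly_exp_leq p n) _.
by rewrite ltnS leq_mul2r; apply/orP; right; lia.
Qed.

Lemma size_mul_leqD (K : fieldType) (p r : {poly K}) (m n : nat) :
  (size p <= m.+1)%N -> (size r <= n.+1)%N -> (size (p * r)%R <= (m + n).+1)%N.
Proof. by move=> sp sr; have := size_polyMleq p r; lia. Qed.

(** Square order replaces the usual derivatives: on the points, [(th - v) ^+ (i * X * X)] collapses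
    to [(th - v ^+ (X * X)) ^+ i], so an [X]-th power of high degree agrees there with a polynomial
    of low degree. *)
Lemma stepanov (K : closedFieldType) (X s M G : nat) (f f0 b : {poly K})
    (v gam : K) (rs : seq K) :
  [pchar K].-nat X -> (4 <= X)%N -> (s * M = X.-1)%N ->
  (size f <= G.+1)%N -> (size b <= G.+1)%N ->
  f = ('X - v%:P) * f0 -> f0.[v] != 0 -> b.[v] != 0 ->
  uniq rs ->
  {in rs, forall th, [/\ th ^+ (X * X) = th, f.[th] != 0, b.[th] != 0
                 & (f.[th] / b.[th]) ^+ (X.+1 * M) = gam]} ->
  (size rs <= (M + 3 * G + 4) * X)%N.
Proof.
move=> pX X4 sM sf sb fE f0v bv urs Hrs.
have s0 : (0 < s)%N by case: (s) sM => //; lia.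
have M0 : (0 < M)%N by case: (M) sM => //; lia.
have sM1 : (s.-1 * M + M = X.-1)%N by rewrite -mulSnr prednK.
(* The constant [2 * G + 4] makes the number [I * X.-1] of unknowns exceed the size bound
   [M * X + I + G * X] for every [X >= 4]. *)
pose I := (M + 2 * G + 4)%N; pose N := (I * X.-1)%N.
pose i_ (n : 'I_N) := (n %/ X.-1)%N; pose r_ (n : 'I_N) := (n %% X.-1)%N.
pose j_ n := (r_ n %/ M)%N; pose a_ n := (r_ n %% M)%N.
have iI n : (i_ n < I)%N by rewrite ltn_divLR //; lia.
have rX n : (r_ n < X.-1)%N by rewrite ltn_mod; lia.
have js n : (j_ n < s)%N by rewrite ltn_divLR // sM.
have aM n : (a_ n < M)%N by rewrite ltn_mod.
have rE n : r_ n = (j_ n * M + a_ n)%N by exact: divn_eq.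
(* On the points considered, [b ^+ ((s.-1 * M) * X) * \sum_n e n *: T n] agrees
   with [f ^+ (s.-1 * M) * R ^+ X] when [c n ^+ X = e n], with [R] as below: a
   linear system of low degree makes [R] vanish there. *)
pose T n := gam ^+ j_ n *: (('X - v%:P) ^+ (a_ n * X) * ('X - (v ^+ (X * X))%:P) ^+ i_ n
              * (f ^+ ((s.-1 - j_ n) * M) * b ^+ (j_ n * M))).
have [|n|e [n0 en0] eT] := @polys_dependent K N (M * X + I + G * X) T.
- rewrite /N /I.
  have : ((s.-1).+1 * M = X.-1)%N by rewrite prednK.
  case: (X) X4 => [//|[//|[//|[//|X']]]] _ /=; nia.
- apply: leq_trans (size_scale_leq _ _) _.
  have sXv (x : K) m : (size (('X - x%:P) ^+ m) <= m.+1)%N.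
    by rewrite size_exp_XsubC.
  apply: leq_trans (size_mul_leqD (size_mul_leqD (sXv _ _) (sXv _ _))
    (size_mul_leqD (size_exp_leq _ sf) (size_exp_leq _ sb))) _.
  have h1 : (a_ n * X <= M.-1 * X)%N by rewrite leq_mul2r; apply/orP; right; have := aM n; lia.
  have h2 : (G * ((s.-1 - j_ n) * M) + G * (j_ n * M) <= G * X)%N.
    rewrite -mulnDr -mulnDl subnK; last by have := js n; lia.
    rewrite leq_mul2l; apply/orP; right; lia.
  have h3 : (M.-1 * X + X = M * X)%N by rewrite -mulSnr prednK.
  have := iI n; lia.
have [c cE] : exists c : 'I_N -> K, forall n, c n ^+ X = e n.
  have root n : exists x, x ^+ X == e n.
    have /closed_rootP [x] : size ('X^X - (e n)%:P) != 1%N.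
      by rewrite size_XnsubC; lia.
    by rewrite /root hornerD hornerN hornerC hornerXn subr_eq0; exists x.
  by exists (fun n => xchoose (root n)) => n; apply/eqP/(xchooseP (root n)).
pose R := \sum_n c n *: (('X - v%:P) ^+ (a_ n + i_ n * X)
             * (f ^+ (j_ n * M) * b ^+ ((s.-1 - j_ n) * M))).
(* The terms of [R] vanish at [v] to pairwise distinct orders. *)
have R0 : R != 0.
  apply: contraNneq en0 => R0.
  pose U n := f0 ^+ (j_ n * M) * b ^+ ((s.-1 - j_ n) * M).
  (* The simple zero of [f] contributes [j_ n * M], completing [a_ n] to [r_ n]; as [r_ n < X.-1],
     these orders increase strictly with [n]. *)
  pose o n := (i_ n * X + r_ n)%N.
  have om : {homo o : m n / (m < n)%N}.
    move=> m n mn; rewrite /o.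
    have := divn_eq m X.-1; have := divn_eq n X.-1.
    rewrite -/(i_ m) -/(i_ n) -/(r_ m) -/(r_ n) => En Em.
    have := rX m; have := rX n => rn rm.
    have [lt|] := ltnP (i_ m) (i_ n).
      have : (i_ n * X >= (i_ m).+1 * X)%N by rewrite leq_mul2r lt orbT.
      lia.
    rewrite leq_eqVlt => /orP [/eqP ein|lt]; first by move: Em En mn; rewrite ein; lia.
    have : (i_ m * X.-1 >= (i_ n).+1 * X.-1)%N by rewrite leq_mul2r lt orbT.
    lia.
  have UE n : c n *: (('X - v%:P) ^+ o n * U n) = c n *: (('X - v%:P) ^+ (a_ n + i_ n * X)
             * (f ^+ (j_ n * M) * b ^+ ((s.-1 - j_ n) * M))).
    congr (_ *: _); rewrite /U fE exprMn mulrA mulrA mulrA -exprD /o rE.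
    by congr (_ ^+ _ * _ * _); lia.
  have Uv n : (U n).[v] != 0 by rewrite /U hornerM !horner_exp mulf_neq0 // expf_neq0.
  have c0 : c n0 = 0.
    by apply: (lowest_term om Uv); rewrite (eq_bigr _ (fun n _ => UE n)) -/R R0.
  by rewrite -cE c0 expr0n; case: (X) X4.
have sR : (size R <= (I + G) * X)%N.
  apply: leq_trans (size_sum _ _ _) _; apply/bigmax_leqP => n _.
  apply: leq_trans (size_scale_leq _ _) _.
  have sXv (x : K) m : (size (('X - x%:P) ^+ m) <= m.+1)%N.
    by rewrite size_exp_XsubC.
  apply: leq_trans (size_mul_leqD (sXv _ _)
    (size_mul_leqD (size_exp_leq _ sf) (size_exp_leq _ sb))) _.
  have h2 : (G * (j_ n * M) + G * ((s.-1 - j_ n) * M) <= G * X)%N.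
    rewrite -mulnDr -mulnDl addnC subnK; last by have := js n; lia.
    rewrite leq_mul2l; apply/orP; right; lia.
  have h1 : (i_ n * X <= I.-1 * X)%N by rewrite leq_mul2r; apply/orP; right; have := iI n; lia.
  have h3 : (I.-1 * X + X = I * X)%N by rewrite -mulSnr prednK // /I addn4.
  have h4 : (M <= X.-1)%N by rewrite -sM leq_pmull.
  have := aM n; lia.
have Rrs : all (root R) rs.
  apply/allP => th /Hrs [thX fth bth wth].
  have expX (x y : K) : (x - y) ^+ X = x ^+ X - y ^+ X by rewrite exprDn_pchar // exprNn_pchar.
  have sumX (h : 'I_N -> K) : (\sum_n h n) ^+ X = \sum_n h n ^+ X.
    apply: (big_morph (fun x => x ^+ X)) => [x y|]; first exact: exprDn_pchar.
    by rewrite expr0n; case: (X) X4.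
  suff : f.[th] ^+ (s.-1 * M) * R.[th] ^+ X = 0.
    by move/eqP; rewrite mulf_eq0 !expf_eq0 (negPf fth) andbF /= => /andP [].
  transitivity (b.[th] ^+ (s.-1 * M * X) * (\sum_n e n *: T n).[th]);
    last by rewrite eT horner0 mulr0.
  rewrite /R !horner_sum sumX !mulr_sumr; apply: eq_bigr => n _.
  rewrite !(hornerZ, hornerM, horner_exp, hornerXsubC) exprMn cE.
  rewrite !exprMn -!exprM.
  have -> : (th - v) ^+ ((a_ n + i_ n * X) * X) = (th - v) ^+ (a_ n * X) * (th - v ^+ (X * X)) ^+ i_ n.
    rewrite mulnDl exprD; congr (_ * _); rewrite -{2}thX.
    by rewrite -mulnA mulnC exprM; congr (_ ^+ _); rewrite !exprM !expX.
  have [w wE] : exists w, w = f.[th] / b.[th] by exists (f.[th] / b.[th]).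
  have fE' : f.[th] = w * b.[th] by rewrite wE divfK.
  rewrite -wE in wth; rewrite fE' !exprMn -wth.
  have [j' jE] : exists j', (s.-1 = j_ n + j')%N by exists (s.-1 - j_ n)%N; rewrite subnKC // -ltnS prednK.
  rewrite jE addKn -!exprM.
  have -> : w ^+ ((j_ n + j') * M) = w ^+ (j_ n * M) * w ^+ (j' * M) by rewrite -exprD mulnDl.
  (* This is [gam ^+ j_ n]: the second factor comes from [R ^+ X], the first is part of the power of
     [f] multiplied in front. *)
  have -> : w ^+ (X.+1 * M * j_ n) = w ^+ (j_ n * M) * w ^+ (j_ n * M * X).
    by rewrite -exprD; congr (_ ^+ _); lia.
  have -> : b.[th] ^+ ((j_ n + j') * M * X) = b.[th] ^+ (j_ n * M * X) * b.[th] ^+ (j' * M * X).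
    by rewrite -exprD; congr (_ ^+ _); lia.
  have -> : b.[th] ^+ ((j_ n + j') * M) = b.[th] ^+ (j_ n * M) * b.[th] ^+ (j' * M).
    by rewrite -exprD; congr (_ ^+ _); lia.
  ring.
apply: leq_trans (ltnW (max_poly_roots R0 Rrs urs)) _.
by apply: leq_trans sR _; rewrite leq_mul2r /I; apply/orP; right; lia.
Qed.

(** * Power sums *)

Lemma bounded_powers_le1 (x C : algC) :
  0 <= x -> (forall u, x ^+ u.+1 <= C) -> x <= 1.
Proof.
move=> x0 xC; rewrite real_leNgt ?ger0_real //; apply/negP => x1.
have bern u : 1 + u%:R * (x - 1) <= x ^+ u.
  elim: u => [|u IH]; first by rewrite mul0r addr0.
  rewrite exprS; apply: le_trans (ler_wpM2l x0 IH).
  rewrite -subr_ge0.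
  have -> : x * (1 + u%:R * (x - 1)) - (1 + u.+1%:R * (x - 1)) = u%:R * (x - 1) ^+ 2.
    by rewrite -natr1; ring.
  by rewrite mulr_ge0 ?ler0n // exprn_ge0 // subr_ge0 ltW.
have C0 : 0 <= C by apply: le_trans (xC 0); rewrite expr1.
have d0 : 0 < x - 1 by rewrite subr_gt0.
have /archi_boundP : 0 <= C / (x - 1) by rewrite divr_ge0 // ltW.
rewrite ltr_pdivrMr //; set N := Num.bound _ => CN.
have := le_trans (bern N.+1) (xC N).
rewrite real_leNgt ?ger0_real //; last first.
  by rewrite addr_ge0 // mulr_ge0 // ltW.
move/negP; apply; apply: lt_le_trans CN _.
rewrite -subr_ge0; suff -> : 1 + N.+1%:R * (x - 1) - N%:R * (x - 1) = x by [].
by rewrite -natr1; ring.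
Qed.

(** Only the growth in [u] matters, so [C] does not appear in the conclusion; this is why a crude
    estimate of the character sums suffices. *)
Lemma power_sum_bound (om : seq algC) (C B : algC) : 0 < B ->
  (forall u, `|\sum_(w <- om) w ^+ u.+1| <= C * B ^+ u.+1) ->
  {in om, forall w, `|w| <= B}.
Proof.
move=> B0 bnd z0 z0om.
(* Applying [P] of the shift to the power sums isolates the powers of [z0]. *)
pose P := \prod_(w <- undup om | w != z0) ('X - w%:P).
have Pz z : z \in om -> z != z0 -> P.[z] = 0.
  move=> zom zz0; rewrite /P horner_prod.
  by rewrite (big_rem z) ?mem_undup //= zz0 hornerXsubC subrr mul0r.
have Pz0 : P.[z0] != 0.
  rewrite /P horner_prod prodf_seq_neq0; apply/allP => w _; apply/implyP.
  by rewrite hornerXsubC subr_eq0 eq_sym.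
have key u : \sum_(k < size P) P`_k * (\sum_(w <- om) w ^+ (u.+1 + k))
    = (count_mem z0 om)%:R * (z0 ^+ u.+1 * P.[z0]).
  transitivity (\sum_(w <- om) w ^+ u.+1 * P.[w]).
    under eq_bigr => k _ do rewrite mulr_sumr.
    rewrite exchange_big; apply: eq_bigr => w _ /=.
    by rewrite horner_coef mulr_sumr; apply: eq_bigr => k _; rewrite exprD; ring.
  rewrite (bigID (pred1 z0)) /= [X in _ + X]big_seq_cond [X in _ + X]big1 ?addr0; last first.
    by move=> w /andP [wom /= wz]; rewrite Pz ?mulr0.
  rewrite (eq_bigr (fun _ => z0 ^+ u.+1 * P.[z0])); last by move=> w /eqP ->.
  by rewrite big_const_seq iter_addr_0 mulr_natl.
pose D := (\sum_(k < size P) `|P`_k| * (C * B ^+ k)) / ((count_mem z0 om)%:R * `|P.[z0]|).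
have cnt0 : 0 < (count_mem z0 om)%:R :> algC by rewrite ltr0n -has_count has_pred1.
have : `|z0| / B <= 1.
  apply: (@bounded_powers_le1 _ D) => [|u]; first by rewrite divr_ge0 // ltW.
  rewrite expr_div_n /D ler_pdivrMr ?exprn_gt0 // mulrAC ler_pdivlMr; last first.
    by rewrite mulr_gt0 // normr_gt0.
  have -> : `|z0| ^+ u.+1 * ((count_mem z0 om)%:R * `|P.[z0]|)
     = `|(count_mem z0 om)%:R * (z0 ^+ u.+1 * P.[z0])|.
    by rewrite !normrM normrX normr_nat; ring.
  rewrite -key; apply: le_trans (ler_norm_sum _ _ _) _.
  rewrite mulr_suml; apply: ler_sum => k _.
  rewrite normrM -mulrA ler_wpM2l // addSn; apply: le_trans (bnd _) _.
  by rewrite -mulrA -exprD addnS addnC.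
by rewrite ler_pdivrMr // mul1r.
Qed.

Lemma newton_power_sums (R : comNzRingType) (om : seq R) (n : nat) :
  let E := \prod_(w <- om) (1 - w *: 'X) in
  E`_n.+1 *+ n.+1 = - \sum_(i < n.+1) (\sum_(w <- om) w ^+ i.+1) * E`_(n - i).
Proof.
move=> /=; elim: om n => [|w om IH] n.
  by rewrite big_nil coef1 mul0rn big1 ?oppr0 // => i _; rewrite big_nil mul0r.
rewrite big_cons; set E := \prod_(j <- om) _ in IH *; set E' := _ * E.
have E'S m : E'`_m.+1 = E`_m.+1 - w * E`_m.
  by rewrite /E' mulrBl mul1r coefB -scalerAl coefZ coefXM.
have E'0 : E'`_0 = E`_0 by rewrite /E' mulrBl mul1r coefB -scalerAl coefZ coefXM /= mulr0 subr0.
(* The new root contributes the series [w X / (1 - w X)], whose denominator cancels against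
   [E' = (1 - w X) E]. *)
have tel m : \sum_(i < m.+1) w ^+ i.+1 * E'`_(m - i) = w * E`_m.
  elim: m => [|m IHm]; first by rewrite big_ord1 E'0 expr1.
  rewrite big_ord_recl subn0 E'S /=.
  under eq_bigr => i _ do rewrite /bump /= add1n exprS -mulrA subSS.
  by rewrite -mulr_sumr IHm expr1; ring.
transitivity (- (\sum_(i < n.+1) (\sum_(v <- om) v ^+ i.+1) * E'`_(n - i)
                 + \sum_(i < n.+1) w ^+ i.+1 * E'`_(n - i))); last first.
  rewrite -big_split /=; congr (- _); apply: eq_bigr => i _.
  by rewrite big_cons; ring.
rewrite tel E'S mulrnBl IH.
case: n => [|n].
  by rewrite !big_ord1 E'0 mulr1n; ring.
rewrite big_ord_recr /= [X in _ = - (X + _)]big_ord_recr /= subnn E'0.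
have -> : \sum_(i < n.+1) (\sum_(v <- om) v ^+ i.+1) * E'`_(n.+1 - i)
  = \sum_(i < n.+1) (\sum_(v <- om) v ^+ i.+1) * E`_(n.+1 - i)
    + w * (E`_n.+1 *+ n.+1).
  rewrite IH mulrN mulr_sumr -sumrB; apply: eq_bigr => i _.
  by rewrite subSn ?E'S -1?ltnS //; ring.
by rewrite mulrSr; ring.
Qed.

(** Since [c 0 = 1], the recursion can be solved for [S n.+1]. This identifies character sums with
    power sums of roots without formal power series. *)
Lemma newton_unique (R : comNzRingType) (c S T : nat -> R) : c 0%N = 1 ->
  (forall n, c n.+1 *+ n.+1 = \sum_(i < n.+1) S i.+1 * c (n - i)%N) ->
  (forall n, c n.+1 *+ n.+1 = \sum_(i < n.+1) T i.+1 * c (n - i)%N) ->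
  forall n, S n.+1 = T n.+1.
Proof.
move=> c0 HS HT; elim/ltn_ind => n IH.
have := HS n; rewrite HT !big_ord_recr /= subnn c0 !mulr1.
rewrite (eq_bigr (fun i : 'I_n => S i.+1 * c (n - i)%N)); first by move/addrI.
by move=> i _; rewrite IH.
Qed.

Lemma unit_poly_factor (P : {poly algC}) : P`_0 = 1 ->
  exists2 om : seq algC, P = \prod_(w <- om) (1 - w *: 'X) & size om = (size P).-1.
Proof.
move=> P0; have [rs PE] := closed_field_poly_normal P.
have lP : lead_coef P != 0.
  by rewrite lead_coef_eq0; apply: contra_eq_neq P0 => ->; rewrite coef0 eq_sym oner_eq0.
exists [seq x^-1 | x <- rs]; last first.
  by rewrite size_map {1}PE size_scale // size_prod_XsubC.
have P0' : P.[0] = 1 by rewrite horner_coef0.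
have rs0 : {in rs, forall x, x != 0}.
  move=> x xrs; apply: contra_eq_neq P0' => x0.
  rewrite PE hornerZ horner_prod (big_rem x) //= hornerXsubC x0 subrr mul0r mulr0.
  by rewrite eq_sym oner_eq0.
have -> : P = (lead_coef P * \prod_(x <- rs) (- x)) *: \prod_(x <- rs) (1 - x^-1 *: 'X).
  rewrite -scalerA {1}PE; congr (_ *: _).
  rewrite -mul_polyC rmorph_prod -big_split; apply: eq_big_seq => x xrs /=.
  rewrite mul_polyC scalerBr scalerA mulNr mulfV ?rs0 // scaleN1r opprK addrC.
  by rewrite scaleNr alg_polyC.
have -> : lead_coef P * \prod_(x <- rs) - x = 1.
  transitivity P.[0]; last exact: P0'.
  rewrite [in RHS]PE hornerZ horner_prod; congr (_ * _).
  by apply: eq_bigr => x _; rewrite hornerXsubC sub0r.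
by rewrite scale1r big_map.
Qed.

(** * Points over finite extensions and their conjugates *)

Section FiniteFieldPoints.

Variables (F : finFieldType) (K : closedFieldType) (emb : {rmorphism F -> K}).
Local Notation Q := #|F|.
Hypothesis pQ : [pchar K].-nat Q.

Lemma card_gt1 : (1 < Q)%N.
Proof. exact: finNzRing_gt1. Qed.

Lemma pQn i : [pchar K].-nat (Q ^ i)%N.
Proof. by rewrite pnatX pQ. Qed.

Lemma frobD i (x y : K) : (x + y) ^+ (Q ^ i) = x ^+ (Q ^ i) + y ^+ (Q ^ i).
Proof. exact/exprDn_pchar/pQn. Qed.

Lemma frobB i (x y : K) : (x - y) ^+ (Q ^ i) = x ^+ (Q ^ i) - y ^+ (Q ^ i).
Proof. by rewrite frobD exprNn_pchar ?pQn. Qed.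

Lemma frob_inj i : injective (fun x : K => x ^+ (Q ^ i)).
Proof.
move=> x y /= /eqP; rewrite -subr_eq0 -frobB expf_eq0 subr_eq0.
by case/andP => _ /eqP.
Qed.

Lemma natr_pchar_eq0 N : (1 < N)%N -> [pchar K].-nat N -> N%:R = 0 :> K.
Proof.
move=> N1 /pnatP H; have p1 := pdiv_prime N1.
have pp : pdiv N \in [pchar K] by apply: H; rewrite ?pdiv_dvd // ltnW.
by apply/eqP; rewrite -(dvdn_pcharf pp) pdiv_dvd.
Qed.

(** The subfield of order [Q ^ i] as a list of points of [K]. For [i = 0] the polynomial is 0 and
    the list carries no meaning, hence the conditions [0 < i] below. *)
Definition ext_points i : seq K := sval (closed_field_poly_normal ('X^(Q ^ i) - 'X)).

Lemma expQ_gt1 i : (0 < i)%N -> (1 < Q ^ i)%N.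
Proof. by move=> i0; rewrite -(expn0 Q) ltn_exp2l // card_gt1. Qed.

Lemma size_XnX i : (0 < i)%N -> size ('X^(Q ^ i) - 'X : {poly K}) = (Q ^ i).+1.
Proof.
by move=> i0; rewrite size_polyDl ?size_polyXn // size_polyN size_polyX ltnS expQ_gt1.
Qed.

Lemma ext_pointsE i : (0 < i)%N ->
  'X^(Q ^ i) - 'X = \prod_(z <- ext_points i) ('X - z%:P).
Proof.
move=> i0; rewrite /ext_points; case: closed_field_poly_normal => r /= {1}->.
rewrite lead_coefDl ?lead_coefXn ?scale1r //.
by rewrite size_polyXn size_polyN size_polyX ltnS expQ_gt1.
Qed.

Lemma mem_ext_points i th : (0 < i)%N -> (th \in ext_points i) = (th ^+ (Q ^ i) == th).
Proof.
move=> i0; rewrite -root_prod_XsubC -ext_pointsE // /root.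
by rewrite hornerD hornerN hornerX hornerXn subr_eq0.
Qed.

Lemma size_ext_points i : (0 < i)%N -> size (ext_points i) = (Q ^ i)%N.
Proof.
by move=> i0; apply: succn_inj; rewrite -size_XnX // ext_pointsE // size_prod_XsubC.
Qed.

Lemma ext_points_uniq i : (0 < i)%N -> uniq (ext_points i).
Proof.
move=> i0; rewrite -separable_prod_XsubC -ext_pointsE // unlock.
rewrite derivB derivXn derivX -scaler_nat natr_pchar_eq0 ?pQn ?expQ_gt1 //.
by rewrite scale0r sub0r -(scaleN1r (1 : {poly K})) coprimepZr ?coprimep1 // oppr_eq0 oner_eq0.
Qed.

Lemma emb_fix a : emb a ^+ Q = emb a.
Proof. by rewrite -rmorphXn /= expf_card. Qed.

Lemma frob_fixed x : x ^+ Q = x -> exists a, emb a = x.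
Proof.
move=> xQ; have u : uniq [seq emb a | a <- enum F].
  by rewrite map_inj_uniq ?enum_uniq //; exact: fmorph_inj.
have s : {subset [seq emb a | a <- enum F] <= ext_points 1}.
  by move=> _ /mapP [a _ ->]; rewrite mem_ext_points // expn1 emb_fix.
have [|_ E] := uniq_min_size u s; first by rewrite size_map -cardE size_ext_points // expn1.
have : x \in ext_points 1 by rewrite mem_ext_points // expn1 xQ.
by rewrite -E => /mapP [a _ ->]; exists a.
Qed.

Definition emb_inv x : F := odflt 0 [pick a | emb a == x].

Lemma emb_invK x : x ^+ Q = x -> emb (emb_inv x) = x.
Proof.
move=> /frob_fixed [a <-]; rewrite /emb_inv; case: pickP => [b /eqP //|/(_ a)].
by rewrite eqxx.
Qed.

Definition descend (g : {poly K}) : {poly F} := \poly_(i < size g) emb_inv g`_i.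

Lemma descendK (g : {poly K}) : (forall i, g`_i ^+ Q = g`_i) ->
  map_poly emb (descend g) = g.
Proof.
move=> gQ; apply/polyP => i; rewrite coef_map coef_poly.
case: (ltnP i (size g)) => [_|h]; first exact: emb_invK.
by rewrite nth_default //; exact: (rmorph0 emb).
Qed.

Lemma coef_prod_frob (s : seq K) k :
  (\prod_(x <- s) ('X - x%:P))`_k ^+ Q = (\prod_(x <- s) ('X - (x ^+ Q)%:P))`_k.
Proof.
elim: s k => [|x s IH] k.
  by rewrite !big_nil coef1; case: (k == 0%N); rewrite ?expr1n ?expr0n // gtn_eqF // ltnW ?card_gt1.
rewrite !big_cons !mulrBl !coefB !coefXM !coefCM -[in LHS](expn1 Q) frobB expn1 exprMn IH.
case: (k == 0%N); last by rewrite IH.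
by rewrite expr0n gtn_eqF // ltnW ?card_gt1.
Qed.

(** For [th] in the extension of degree [i] this is its characteristic polynomial over [F]: a proper
    power of the minimal polynomial when [th] lies in a smaller extension. *)
Definition conj_poly i (th : K) : {poly K} := \prod_(j < i) ('X - (th ^+ (Q ^ j))%:P).

Lemma conj_polyE i th :
  conj_poly i th = \prod_(x <- [seq th ^+ (Q ^ j) | j <- iota 0 i]) ('X - x%:P).
Proof.
rewrite big_map; transitivity (\prod_(0 <= j < i) ('X - (th ^+ (Q ^ j))%:P)).
  by rewrite big_mkord.
by rewrite /index_iota subn0.
Qed.

Lemma conj_poly_monic i th : conj_poly i th \is monic.
Proof. exact: monic_prod_XsubC. Qed.

Lemma size_conj_poly i th : size (conj_poly i th) = i.+1.
Proof. by rewrite conj_polyE size_prod_XsubC size_map size_iota. Qed.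

(** Frobenius permutes the linear factors cyclically, so the coefficients are fixed by it. *)
Lemma conj_poly_fix i th : (0 < i)%N -> th ^+ (Q ^ i) = th ->
  map_poly emb (descend (conj_poly i th)) = conj_poly i th.
Proof.
case: i => // i _ thQ; apply: descendK => k.
rewrite conj_polyE coef_prod_frob; congr (polyseq _)`__.
rewrite !big_map; transitivity (\prod_(1 <= j < i.+2) ('X - (th ^+ (Q ^ j))%:P)).
  rewrite big_add1 /= /index_iota subn0; apply: eq_bigr => j _.
  by rewrite -exprM expnSr.
rewrite -[iota 0 i.+1]/(index_iota 0 i.+1) big_nat_recr //= mulrC thQ.
by rewrite [RHS]big_ltn // expn0 expr1.
Qed.

Definition monics e : seq {poly F} := [seq 'X^e + rVpoly v | v : 'rV[F]_e].

Lemma mem_monics e g : (g \in monics e) = (g \is monic) && (size g == e.+1).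
Proof.
apply/mapP/andP => [[v _ ->]|[mg /eqP sg]].
  have s : (size (rVpoly v) < size ('X^e : {poly F}))%N.
    by rewrite size_polyXn ltnS size_poly.
  by rewrite monicE lead_coefDl // lead_coefXn size_polyDl // size_polyXn !eqxx.
have sg' : (size (g - 'X^e)%R <= e)%N; last first.
  by exists (poly_rV (g - 'X^e)); rewrite ?mem_enum // poly_rV_K // addrC subrK.
apply/leq_sizeP => j; rewrite leq_eqVlt => /orP [/eqP <-|lt].
  by rewrite coefB coefXn eqxx -[e]/(e.+1.-1) -sg -lead_coefE (monicP mg) subrr.
by rewrite coefB coefXn gtn_eqF // subr0 nth_default // sg.
Qed.

Lemma monics_uniq e : uniq (monics e).
Proof.
by rewrite map_inj_uniq ?enum_uniq // => v w /addrI /(can_inj rVpolyK).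
Qed.

End FiniteFieldPoints.

(** * Characteristic polynomials dividing a given polynomial *)

Lemma sum_multiples d m r : (0 < d)%N -> (d * m <= r)%N ->
  (\sum_(i < r) ((d %| i.+1) && (i.+1 %/ d <= m)) = m)%N.
Proof.
move=> d0 dmr; pose P i := ((d %| i) && (i %/ d <= m))%N.
transitivity (\sum_(i <- iota 1 r) P i)%N.
  rewrite -(big_mkord xpredT (fun i => P i.+1 : nat)) -[iota 1 r]/(iota (1 + 0) r) iotaDl big_map.
  by rewrite /index_iota subn0.
rewrite -big_mkcondr /= sum1_count -size_filter -[RHS](size_iota 1 m) -[RHS](size_map (muln d)).
apply: perm_size; apply: uniq_perm.
- exact/filter_uniq/iota_uniq.
- by rewrite map_inj_uniq ?iota_uniq // => x y /eqP; rewrite eqn_pmul2l // => /eqP.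
move=> x; rewrite mem_filter /P; apply/idP/mapP => [|[k kI ->]].
  case/andP => /andP [/dvdnP [k ->]]; rewrite mulnK // !mem_iota => km kI.
  by exists k; rewrite ?mem_iota 1?mulnC //; nia.
move: kI; rewrite dvdn_mulr // mulKn //= !mem_iota => kI; apply/andP; split; first by lia.
by apply/andP; split; nia.
Qed.

Section CountDivisors.

Variables (F : finFieldType) (K : closedFieldType) (emb : {rmorphism F -> K}).
Local Notation Q := #|F|.
Hypothesis pQ : [pchar K].-nat Q.
Local Notation "g ^e" := (map_poly emb g) (at level 2, format "g ^e").

Lemma horner_frob (g : {poly F}) j x : (g^e).[x ^+ (Q ^ j)] = (g^e).[x] ^+ (Q ^ j).
Proof.
have sumX (I : Type) (s : seq I) (h : I -> K) :
    (\sum_(n <- s) h n) ^+ Q = \sum_(n <- s) h n ^+ Q.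
  apply: (big_morph (fun x => x ^+ Q)) => [u v|]; first exact: exprDn_pchar.
  by rewrite expr0n gtn_eqF // ltnW ?card_gt1.
elim: j => [|j IH]; first by rewrite expn0 !expr1.
rewrite !expnSr !exprM -IH !horner_coef sumX; apply: eq_bigr => i _.
by rewrite exprMn coef_map emb_fix // exprAC.
Qed.

Lemma root_periodic (g : {poly F}) th : g != 0 -> root g^e th ->
  exists2 d, (0 < d)%N & th ^+ (Q ^ d) = th.
Proof.
move=> g0 rg; have G0 : g^e != 0 by rewrite map_poly_eq0.
pose s := [seq th ^+ (Q ^ j) | j <- iota 0 (size g^e)].
have rs : all (root g^e) s.
  apply/allP => _ /mapP [j _ ->]; rewrite /root horner_frob (eqP rg) expr0n.
  by rewrite gtn_eqF // expn_gt0 ltnW ?card_gt1.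
have : ~~ uniq s.
  by apply/negP => /(max_poly_roots G0 rs); rewrite size_map size_iota ltnn.
case/(uniqPn 0) => i [j [ij]]; rewrite size_map size_iota => jlt.
have ilt := ltn_trans ij jlt; rewrite !(nth_map 0%N) ?size_iota ?nth_iota //.
rewrite !add0n => E; exists (j - i)%N; first by rewrite subn_gt0.
by apply: (frob_inj pQ (i := i)); rewrite -exprM -expnD subnK // ltnW.
Qed.

Lemma period_exists (th : K) i0 : (0 < i0)%N -> th ^+ (Q ^ i0) = th ->
  exists d, [/\ (0 < d)%N, forall i, (th ^+ (Q ^ i) == th) = (d %| i)%N
     & uniq [seq th ^+ (Q ^ j) | j <- iota 0 d]].
Proof.
move=> i00 i0P; have ex : exists i, (0 < i)%N && (th ^+ (Q ^ i) == th).
  by exists i0; rewrite i00 i0P /=.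
case: (ex_minnP ex) => d /andP [d0 /eqP dP] dmin.
have mulP k : th ^+ (Q ^ (k * d)) = th.
  by elim: k => [|k IH]; rewrite ?mul0n ?expr1 // mulSn expnD exprM dP.
exists d; split=> // [i|].
  have modP : th ^+ (Q ^ i) = th ^+ (Q ^ (i %% d)).
    by rewrite {1}(divn_eq i d) expnD exprM mulP.
  rewrite modP /dvdn; have [->|m0] := posnP (i %% d)%N; first by rewrite expr1 !eqxx.
  apply/negP => E.
  by have := dmin (i %% d)%N; rewrite m0 E leqNgt ltn_mod d0 => /(_ isT).
apply: contraT => /(uniqPn 0) [i [j [ij]]]; rewrite size_map size_iota => jlt.
have ilt := ltn_trans ij jlt; rewrite !(nth_map 0%N) ?size_iota ?nth_iota //.
rewrite !add0n => E.
have /eqP E' : th ^+ (Q ^ (j - i)) = th.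
  by apply: (frob_inj pQ (i := i)); rewrite -exprM -expnD subnK // ltnW.
have := dmin (j - i)%N; rewrite E' subn_gt0 ij => /(_ isT); lia.
Qed.

Lemma conj_polyX d k (th : K) : th ^+ (Q ^ d) = th ->
  conj_poly F (k * d) th = conj_poly F d th ^+ k.
Proof.
move=> dP; elim: k => [|k IH]; first by rewrite /conj_poly mul0n big_ord0.
rewrite mulSn /conj_poly big_split_ord exprS -/(conj_poly _ _ _) -IH; congr (_ * _).
by apply: eq_bigr => j _ /=; rewrite expnD exprM dP.
Qed.

(** Multiplicity at [th] alone decides because [g] is defined over [F]: each conjugate is then a
    root as well, one copy of [P] splits off, and the quotient is again defined over [F]. Distinct
    conjugates make [X - th] a simple factor of [P]. *)
Lemma conj_polyX_dvd d k (th : K) (g : {poly F}) : (0 < d)%N -> th ^+ (Q ^ d) = th ->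
  uniq [seq th ^+ (Q ^ j) | j <- iota 0 d] -> g != 0 ->
  (conj_poly F d th ^+ k %| g^e) = (k <= mup th g^e)%N.
Proof.
move=> d0 dP ud g0; rewrite mup_geq ?map_poly_eq0 //.
set P := conj_poly F d th.
have thP : P = ('X - th%:P) * \prod_(x <- [seq th ^+ (Q ^ j) | j <- iota 1 d.-1]) ('X - x%:P).
  by rewrite /P conj_polyE; case: (d) d0 => // d' _; rewrite big_cons expr1.
apply/idP/idP => [|]; first by apply: dvdp_trans; rewrite dvdp_exp2r // thP dvdp_mulIl.
have PE : (descend emb P)^e = P by exact: conj_poly_fix.
elim: k g g0 => [|k IH] g g0; first by rewrite !expr0 !dvd1p.
move=> H; have rg : root g^e th.
  by rewrite -dvdp_XsubCl; apply: dvdp_trans H; rewrite exprS dvdp_mulIl.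
have : P %| g^e.
  rewrite /P conj_polyE; apply: uniq_roots_dvdp; last by rewrite uniq_rootsE.
  apply/allP => _ /mapP [j _ ->]; rewrite /root horner_frob (eqP rg) expr0n.
  by rewrite gtn_eqF // expn_gt0 ltnW ?card_gt1.
rewrite -{1}PE dvdp_map => /dvdpP [h hE].
have mE : (h * descend emb P)^e = h^e * P by rewrite rmorphM /= PE.
have h0 : h != 0 by apply: contraNneq g0 => h0; rewrite hE h0 mul0r.
rewrite hE mE exprSr dvdp_mul // IH //.
move: H; rewrite hE mE thP mulrCA exprS dvdp_mul2l ?polyXsubC_eq0 //.
rewrite Gauss_dvdpl //; apply: coprimep_expl; rewrite coprimep_sym coprimep_XsubC /root horner_prod prodf_seq_eq0.
rewrite -all_predC; apply/allP => x xs /=; rewrite hornerXsubC subr_eq0.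
apply: contraTneq ud => E; case: (d) d0 xs => // d' _ xs.
by move: xs => /= xs; rewrite expn0 expr1 {1}E xs.
Qed.

Lemma sum_conj_dvd (g : {poly F}) r th : size g = r.+1 -> root g^e th ->
  (\sum_(i < r) ((th ^+ (Q ^ i.+1) == th)%R && (conj_poly F i.+1 th %| g^e)%R) = mup th g^e)%N.
Proof.
move=> sg rg; have g0 : g != 0 by rewrite -size_poly_eq0 sg.
have [d1 d10 d1P] := root_periodic g0 rg.
have [d [d0 dP ud]] := period_exists d10 d1P.
have dd : th ^+ (Q ^ d) = th by apply/eqP; rewrite dP dvdnn.
rewrite -[RHS](@sum_multiples d _ r) //.
  apply: eq_bigr => i _; rewrite dP; congr nat_of_bool.
  apply: andb_id2l => /dvdnP [k ->].
  by rewrite mulnK // conj_polyX // conj_polyX_dvd.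
have : conj_poly F d th ^+ mup th g^e %| g^e by rewrite conj_polyX_dvd.
move/dvdp_leq; rewrite map_poly_eq0 size_map_poly sg => /(_ g0).
by rewrite -conj_polyX // size_conj_poly ltnS mulnC.
Qed.

Lemma sum_count_undup (T : eqType) (s : seq T) : (\sum_(x <- undup s) count_mem x s = size s)%N.
Proof.
rewrite -[RHS](perm_size (perm_count_undup s)) size_flatten /shape sumnE !big_map.
by apply: eq_bigr => x _; rewrite size_nseq.
Qed.

(* A root of multiplicity m and period d is counted for i = d, 2d, ..., md. *)
Lemma count_conj_divisors (g : {poly F}) r : size g = r.+1 ->
  (\sum_(i < r) count (fun th => conj_poly F i.+1 th %| g^e)%R (ext_points F K i.+1) = r)%N.
Proof.
move=> sg; have g0 : g != 0 by rewrite -size_poly_eq0 sg.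
have [rs gE] := closed_field_poly_normal g^e.
have l0 : lead_coef g^e != 0 by rewrite lead_coef_eq0 map_poly_eq0.
have rootE x : root g^e x = (x \in rs) by rewrite gE rootZ // root_prod_XsubC.
have mupE x : mup x g^e = count_mem x rs.
  rewrite -mu_prod_XsubC {1}gE -mul_polyC mupMr // /root hornerC (negPf l0) //.
transitivity (\sum_(x <- undup rs) \sum_(i < r)
   ((x ^+ (Q ^ i.+1) == x)%R && (conj_poly F i.+1 x %| g^e)%R))%N; last first.
  have sr : r = size rs.
    by apply: succn_inj; rewrite -sg -(size_map_poly emb) gE size_scale // size_prod_XsubC.
  rewrite [RHS]sr -[RHS]sum_count_undup; apply: eq_big_seq => x.
  by rewrite mem_undup -rootE => xr; rewrite -mupE; apply: sum_conj_dvd.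
rewrite exchange_big; apply: eq_bigr => i _ /=.
rewrite -big_mkcondr sum1_count -!size_filter; apply: perm_size.
apply: uniq_perm; [exact/filter_uniq/ext_points_uniq|exact/filter_uniq/undup_uniq|].
move=> x; rewrite !mem_filter mem_undup mem_ext_points // andbC; case: eqVneq => //= xQ.
case: (boolP (conj_poly F i.+1 x %| g^e)) => //= H.
rewrite -rootE; apply/esym; rewrite -dvdp_XsubCl; apply: dvdp_trans H.
by rewrite /conj_poly big_ord_recl expr1 dvdp_mulIl.
Qed.

End CountDivisors.

(** * L-functions and the Weil bound *)

Section Convolution.

Variables (F : finFieldType) (K : closedFieldType) (emb : {rmorphism F -> K}).
Local Notation Q := #|F|.
Hypothesis pQ : [pchar K].-nat Q.
Local Notation "g ^e" := (map_poly emb g) (at level 2, format "g ^e").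

Lemma descend_conj_monic i th : (0 < i)%N -> th ^+ (Q ^ i) = th ->
  descend emb (conj_poly F i th) \is monic /\ size (descend emb (conj_poly F i th)) = i.+1.
Proof.
move=> i0 thQ; have E := conj_poly_fix emb pQ i0 thQ.
rewrite -(map_monic emb) -(size_map_poly emb) E size_conj_poly; split=> //.
exact: conj_poly_monic.
Qed.

Lemma monics_dvd (h : {poly F}) i n : h \is monic -> size h = i.+1 -> (i <= n)%N ->
  perm_eq [seq g <- monics F n | h %| g] [seq h * g | g <- monics F (n - i)].
Proof.
move=> mh sh ilen; have h0 : h != 0 by rewrite monic_neq0.
apply: uniq_perm; first exact/filter_uniq/monics_uniq.
  by rewrite map_inj_uniq ?monics_uniq //; exact: mulfI.
move=> g; rewrite mem_filter mem_monics; apply/idP/mapP => [|[k]].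
  case/and3P => /dvdpP [k ->] mk sk; exists k; last by rewrite mulrC.
  move: mk sk; rewrite mulrC monicMl // => mk; rewrite mem_monics mk /=.
  have k0 := monic_neq0 mk.
  by rewrite size_mul // sh addSn /= => /eqP sk; rewrite -subSn // -sk addKn.
rewrite mem_monics => /andP [mk /eqP sk] ->.
rewrite dvdp_mulIl monicMl // mk size_mul ?monic_neq0 // sh sk.
by rewrite addSn /= addnS subnKC.
Qed.

(* The Euler product, as the logarithmic derivative of the L-function. *)
Lemma euler_convolution (lam : {poly F} -> algC) n :
  {in monic &, {morph lam : g h / g * h}} ->
  (\sum_(g <- monics F n.+1) lam g) *+ n.+1 =
  \sum_(i < n.+1)
     (\sum_(th <- ext_points F K i.+1) lam (descend emb (conj_poly F i.+1 th)))
     * (\sum_(g <- monics F (n - i)) lam g).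
Proof.
move=> lamM; rewrite -sumrMnl.
(* The [deg g] copies of [lam g] are distributed over the pairs [(i, th)] whose characteristic
   polynomial divides [g]; after exchanging sums, [g] is replaced by its cofactor. *)
transitivity (\sum_(g <- monics F n.+1) \sum_(i < n.+1)
   \sum_(th <- ext_points F K i.+1) (lam g *+ (conj_poly F i.+1 th %| g^e)%R)).
  apply: eq_big_seq => g; rewrite mem_monics => /andP [_ /eqP sg].
  rewrite -{1}(count_conj_divisors emb pQ sg) -sumrMnr; apply: eq_bigr => i _.
  by rewrite sumrMnr -sum1_count big_mkcond.
rewrite exchange_big; apply: eq_bigr => i _ /=.
rewrite exchange_big mulr_suml; apply: eq_big_seq => th; rewrite mem_ext_points // => /eqP thQ /=.
have [mh sh] := descend_conj_monic (ltn0Sn i) thQ.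
set h := descend _ _ in mh sh *.
have hE : h^e = conj_poly F i.+1 th by exact: conj_poly_fix.
rewrite (eq_bigr (fun g => if h %| g then lam g else 0)); last first.
  by move=> g _; rewrite -hE dvdp_map mulrb.
rewrite -big_mkcond -big_filter (perm_big _ (monics_dvd mh sh (ltn_ord i))) big_map.
rewrite mulr_sumr subSS; apply: eq_big_seq => g; rewrite mem_monics => /andP [mg _].
by rewrite lamM.
Qed.

End Convolution.

(** * Character sums over extensions of even degree *)

Section EvenExtensions.

Variables (F : finFieldType) (K : closedFieldType) (emb : {rmorphism F -> K}).
Local Notation Q := #|F|.
Hypothesis pQ : [pchar K].-nat Q.
Local Notation "g ^e" := (map_poly emb g) (at level 2, format "g ^e").

Variables (f : {poly F}) (al : F) (H s G : nat) (v : K) (f0 : {poly K}).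
Hypotheses (Q4 : (4 <= Q)%N) (s0 : (0 < s)%N) (sQ : (s %| Q.-1)%N) (al0 : al != 0).
Hypotheses (sf : (size f <= G.+1)%N) (HG : (H <= G)%N).
Hypotheses (fv : f^e = ('X - v%:P) * f0) (f0v : f0.[v] != 0) (v0 : v != 0).

(* At the poles of the quotient (th = 0) this is 0, since x / 0 = 0. *)
Definition kummer_value (th : K) : K := (f^e).[th] / (emb al * th ^+ H).

Variable tau : K -> algC.
Variable mu : seq K.
Hypotheses (tau0 : tau 0 = 0) (taule : forall x, `|tau x| <= 1)
  (umu : uniq mu) (mumem : forall x, (x \in mu) = (x ^+ s == 1)) (szmu : size mu = s)
  (summu : \sum_(x <- mu) tau x = 0).

(** The exponent is [Q.-1 %/ s] times [1 + Q + ... + Q ^ i.-1], so [tau] sees a power of the norm to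
    [F]: one character of [F] is lifted to every extension. *)
Definition kummer_sum i :=
  \sum_(th <- ext_points F K i) tau (kummer_value th ^+ ((Q ^ i).-1 %/ s)).

Lemma dvdn_expQ_pred i : (s %| (Q ^ i).-1)%N.
Proof. exact: dvdn_trans sQ (dvdn_pred_predX _ _). Qed.

Lemma expQ_gt_pred i : ((Q ^ i).-1.+1 = Q ^ i)%N.
Proof. by rewrite prednK // expn_gt0 ltnW ?card_gt1. Qed.

Lemma kummer_value_fix i th : (0 < i)%N -> th \in ext_points F K i ->
  kummer_value th ^+ (Q ^ i) = kummer_value th.
Proof.
move=> i0; rewrite mem_ext_points // => /eqP thQ; rewrite /kummer_value expr_div_n.
rewrite -horner_frob // exprMn exprAC thQ; congr (_ / (_ * _)).
elim: i {i0 thQ} => [|i IH]; first by rewrite expr1.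
by rewrite expnSr exprM IH emb_fix.
Qed.

Lemma kummer_value_pow_mu i th : (0 < i)%N -> th \in ext_points F K i ->
  kummer_value th != 0 -> kummer_value th ^+ ((Q ^ i).-1 %/ s) \in mu.
Proof.
move=> i0 thi w0; rewrite mumem -exprM divnK ?dvdn_expQ_pred //.
apply/eqP/(mulfI w0); rewrite -exprS expQ_gt_pred mulr1.
exact: kummer_value_fix.
Qed.

(* Every fiber is bounded above by its expected size plus O(Q^u); as the fibers
   add up to almost everything, this is also a lower bound. *)
Lemma count_kummer_fiber u gam : (0 < u)%N -> gam \in mu ->
  (s * count (fun th => kummer_value th ^+ ((Q ^ (2 * u)).-1 %/ s) == gam)
         (ext_points F K (2 * u)) <= Q ^ u * Q ^ u + s * (3 * G + 4) * Q ^ u)%N.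
Proof.
move=> u0; rewrite mumem => gs; have u20 : (0 < 2 * u)%N by rewrite muln_gt0.
set X := (Q ^ u)%N.
have X4 : (4 <= X)%N by apply: leq_trans Q4 _; rewrite -{1}(expn1 Q) leq_exp2l ?card_gt1.
have XX : (Q ^ (2 * u) = X * X)%N by rewrite mulnC expnM expnS expn1.
set M := (X.-1 %/ s)%N.
have sM : (s * M = X.-1)%N by rewrite mulnC divnK // dvdn_expQ_pred.
have M0 : (0 < M)%N by case: (M) sM => //; rewrite muln0; case: (X) X4 => [|[]].
have EM : ((Q ^ (2 * u)).-1 %/ s = X.+1 * M)%N.
  rewrite XX; have -> : ((X * X).-1 = X.+1 * M * s)%N; last by rewrite mulnK.
  rewrite -mulnA (mulnC M) sM; case: (X) X4 => // x _ /=; lia.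
pose b : {poly K} := emb al *: 'X^H.
have gam0 : gam != 0 by apply: contraTneq gs => ->; rewrite expr0n gtn_eqF // eq_sym oner_eq0.
rewrite -size_filter; set rs := filter _ _.
have bE th : b.[th] = emb al * th ^+ H by rewrite hornerZ hornerXn.
have /(leq_mul (leqnn s)) : (size rs <= (M + 3 * G + 4) * X)%N.
  apply: (@stepanov K X s M G f^e f0 b v gam rs) => //.
  - exact: pQn.
  - by rewrite size_map_poly.
  - by apply: leq_trans (size_scale_leq _ _) _; rewrite size_polyXn.
  - by rewrite bE mulf_neq0 ?fmorph_eq0 // expf_neq0.
  - exact/filter_uniq/ext_points_uniq.
  move=> th; rewrite mem_filter EM => /andP [/eqP wE thi].
  have : kummer_value th != 0.
    by apply: contraNneq gam0 => w0; rewrite -wE w0 expr0n muln_eq0 (gtn_eqF M0).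
  move: wE; rewrite /kummer_value -bE => wE; rewrite mulf_eq0 invr_eq0 negb_or => /andP [].
  by split=> //; move: thi; rewrite mem_ext_points // XX => /eqP.
move=> h; apply: leq_trans h _.
have -> : (s * ((M + 3 * G + 4) * X) = s * M * X + s * (3 * G + 4) * X)%N by ring.
by rewrite sM leq_add2r leq_mul2r leq_pred orbT.
Qed.

(** Zeros of the quotient and its possible pole at 0 are all roots of [f X], which has degree at
    most [G.+1]. *)
Lemma count_kummer_neq0 i : (0 < i)%N ->
  (Q ^ i <= count (fun th => kummer_value th != 0)%R (ext_points F K i) + G.+1)%N.
Proof.
move=> i0; rewrite -(size_ext_points F K i0) -(count_predC (fun th => kummer_value th == 0)) addnC.
rewrite leq_add2l -size_filter.
have fe0 : f^e != 0.
  rewrite fv mulf_neq0 ?polyXsubC_eq0 //; apply: contraNneq f0v => ->.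
  by rewrite horner0.
have fX0 : f^e * 'X != 0 by rewrite mulf_neq0 ?polyX_eq0.
rewrite -ltnS; have := max_poly_roots fX0 (rs := [seq th <- ext_points F K i | kummer_value th == 0]).
move=> H1; apply: leq_trans (H1 _ _) _.
- apply/allP => th; rewrite mem_filter => /andP [+ _].
  rewrite /kummer_value /root hornerM hornerX mulf_eq0 invr_eq0 mulf_eq0 fmorph_eq0 (negPf al0).
  by rewrite expf_eq0 mulf_eq0 => /orP [->|/andP [_ ->]] //; rewrite orbT.
- exact/filter_uniq/ext_points_uniq.
by rewrite size_mulX // size_map_poly.
Qed.

Lemma kummer_sum_even : exists C : nat, forall u, (0 < u)%N ->
  `|kummer_sum (2 * u)| <= (C * Q ^ u)%:R.
Proof.
(* [A * X] is the excess that the upper bound allows each fiber; passing to a lower bound costs the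
   excesses of the other fibers plus the at most [G.+1] points of value 0. *)
pose A := (s * (3 * G + 4))%N; exists (s * (G.+1 + A))%N => u u0.
have u20 : (0 < 2 * u)%N by rewrite muln_gt0.
set X := (Q ^ u)%N.
have X0 : (0 < X)%N by rewrite expn_gt0 ltnW ?card_gt1.
have XX : (Q ^ (2 * u) = X * X)%N by rewrite mulnC expnM expnS expn1.
pose w th := kummer_value th ^+ ((Q ^ (2 * u)).-1 %/ s).
pose N gam := count (fun th => w th == gam) (ext_points F K (2 * u)).
have E0 : ((Q ^ (2 * u)).-1 %/ s != 0)%N.
  rewrite -lt0n divn_gt0 // dvdn_leq ?dvdn_expQ_pred //.
  by have := expQ_gt1 F u20; lia.
have SE : kummer_sum (2 * u) = \sum_(g <- mu) tau g *+ N g.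
  rewrite /kummer_sum.
  transitivity (\sum_(th <- ext_points F K (2 * u)) \sum_(g <- mu) tau g *+ (w th == g)).
    apply: eq_big_seq => th thi; rewrite -/(w th).
    have [w0|w0] := eqVneq (kummer_value th) 0.
      have wth : w th = 0 by rewrite /w w0 expr0n (negPf E0).
      rewrite wth tau0 big1_seq // => g /andP [_]; rewrite mumem.
      by case: (eqVneq (0 : K) g) => // <-; rewrite expr0n gtn_eqF // eq_sym oner_eq0.
    have wm : w th \in mu by exact: kummer_value_pow_mu.
    rewrite (big_rem (w th)) //= eqxx mulr1n big1_seq ?addr0 // => g /andP [_].
    by rewrite mem_rem_uniq // inE eq_sym => /andP [/negPf -> _].
  rewrite exchange_big; apply: eq_bigr => g _ /=.
  by rewrite sumrMnr /N -sum1_count [in RHS]big_mkcond.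
have Nle g : g \in mu -> (s * N g <= X * X + A * X)%N by exact: count_kummer_fiber.
have Nsum : (\sum_(g <- mu) N g + G.+1 >= X * X)%N.
  rewrite -XX; apply: leq_trans (count_kummer_neq0 u20) _; rewrite leq_add2r.
  under [X in (_ <= X)%N]eq_bigr => g _ do rewrite /N -sum1_count big_mkcond.
  rewrite exchange_big -sum1_count big_mkcond big_seq [X in (_ <= X)%N]big_seq /=.
  apply: leq_sum => th thi; case: ifP => // w0.
  have wm : w th \in mu by exact: kummer_value_pow_mu.
  by rewrite (big_rem (w th)) //= eqxx.
have Nge g : g \in mu -> (X * X <= s * N g + s * (G.+1 + A) * X)%N.
  move=> gm; have := Nsum; rewrite (big_rem g) //=.
  have : (s * \sum_(h <- rem g mu) N h <= s.-1 * (X * X + A * X))%N.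
    apply: (@leq_trans (\sum_(h <- rem g mu) (X * X + A * X))).
      rewrite big_distrr big_seq [X in (_ <= X)%N]big_seq.
      by apply: leq_sum => h /mem_rem; exact: Nle.
    by rewrite big_const_seq iter_addn_0 count_predT size_rem // szmu mulnC.
  set R := (\sum_(h <- _) _)%N => h1 h2.
  have : (s * (X * X) <= s * (N g + R + G.+1))%N by rewrite leq_mul2l h2 orbT.
  have : (s.-1 * (X * X + A * X) + (X * X + A * X) = s * (X * X + A * X))%N by rewrite -mulSnr prednK.
  have : (s * G.+1 <= s * G.+1 * X)%N by rewrite leq_pmulr.
  rewrite !mulnDr !mulnDl; lia.
(* Multiplying by [s] avoids the expected size [X * X / s]; subtracting the constant [X * X] changes
   nothing, as [tau] sums to 0 over [mu]. *)
rewrite -(ler_pM2l (x := s%:R)) ?ltr0n // -{1}(normr_nat _ s) -normrM SE mulr_sumr.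
have -> : \sum_(g <- mu) s%:R * (tau g *+ N g)
   = \sum_(g <- mu) tau g * ((s * N g)%:R - (X * X)%:R).
  rewrite [RHS](eq_bigr (fun g => s%:R * (tau g *+ N g) - tau g * (X * X)%:R)); last first.
    by move=> g _; rewrite mulrBr natrM -mulr_natr; congr (_ - _); ring.
  by rewrite sumrB -mulr_suml summu mul0r subr0.
apply: le_trans (ler_norm_sum _ _ _) _.
have -> : s%:R * (s * (G.+1 + A) * X)%:R = \sum_(g <- mu) (s * (G.+1 + A) * X)%:R :> algC.
  by rewrite big_const_seq iter_addr_0 count_predT szmu mulr_natl.
rewrite big_seq [leRHS]big_seq.
apply: ler_sum => g gm; rewrite normrM -[leRHS]mul1r ler_pM //.
rewrite real_ler_norml ?rpredB ?realn // lerBrDr addrC lerBlDr lerBlDl -!natrD !ler_nat Nge //=.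
apply: leq_trans (Nle _ gm) _; rewrite leq_add2l leq_mul2r; apply/orP; right.
by rewrite mulnDr; apply: leq_trans (leq_addl _ _); rewrite leq_pmull.
Qed.

End EvenExtensions.

(** * The L-function of the character and the Weil bound *)

Section Weil.

Variables (F : finFieldType) (K : closedFieldType) (emb : {rmorphism F -> K}).
Local Notation Q := #|F|.
Hypothesis pQ : [pchar K].-nat Q.
Local Notation "g ^e" := (map_poly emb g) (at level 2, format "g ^e").

Variables (f : {poly F}) (al : F) (H s : nat) (V : seq K).
Hypotheses (Q4 : (4 <= Q)%N) (s0 : (0 < s)%N) (sQ : (s %| Q.-1)%N) (al0 : al != 0).
Hypotheses (fV : f^e = emb (lead_coef f) *: \prod_(v <- V) ('X - v%:P)) (uV : uniq V)
  (V0 : 0 \in V) (V2 : (2 <= size V)%N) (f0 : f != 0).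

Variable tau : K -> algC.
Variable mu : seq K.
Hypotheses (tau0 : tau 0 = 0) (tau1 : tau 1 = 1) (taule : forall x, `|tau x| <= 1)
  (tauM : forall x y, x ^+ s = 1 -> y ^+ s = 1 -> tau (x * y) = tau x * tau y)
  (umu : uniq mu) (mumem : forall x, (x \in mu) = (x ^+ s == 1)) (szmu : size mu = s)
  (summu : \sum_(x <- mu) tau x = 0).

Local Notation M := (Q.-1 %/ s)%N.

Lemma expM_unity (x : K) : x ^+ Q = x -> x != 0 -> (x ^+ M) ^+ s = 1.
Proof.
move=> xQ x0; rewrite -exprM divnK //; apply: (mulfI x0).
by rewrite -exprS prednK ?mulr1 // ltnW ?card_gt1.
Qed.

Lemma M_gt0 : (0 < M)%N.
Proof. by rewrite divn_gt0 // dvdn_leq //; case: #|F| Q4 => [|[]]. Qed.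

Lemma tau_expM (x y : K) : x ^+ Q = x -> y ^+ Q = y ->
  tau ((x * y) ^+ M) = tau (x ^+ M) * tau (y ^+ M).
Proof.
move=> xQ yQ; rewrite exprMn; have M0 := M_gt0.
have [->|x0] := eqVneq x 0; first by rewrite expr0n gtn_eqF // !mul0r tau0 mul0r.
have [->|y0] := eqVneq y 0; first by rewrite expr0n gtn_eqF // !mulr0 tau0 mulr0.
by rewrite tauM ?expM_unity.
Qed.

Lemma norm_tau_expM (x : K) : x ^+ Q = x -> x != 0 -> `|tau (x ^+ M)| = 1.
Proof.
move=> xQ x0; apply/eqP; rewrite eq_le taule /=.
have : tau (x ^+ M) * tau (x^-1 ^+ M) = 1.
  by rewrite -tau_expM ?mulfV ?expr1n ?tau1 // exprVn xQ.
by move/(congr1 Num.norm); rewrite normrM normr1 => <-; rewrite ler_piMr.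
Qed.

(* For monic [g] with roots [th], [poly_value g] is the product of the
   [kummer_value th].  It is written through the roots [V] of [f] (which include
   0), so that it visibly depends on [g] only mod [f], up to the power of
   [value_lead]; it is 0 when [g] and [f] have a common root. *)
Definition poly_value0 (g : {poly K}) : K := (\prod_(v <- V) g.[v]) / g.[0] ^+ H.
Definition value_lead : K := emb (lead_coef f) * (-1) ^+ size V / (emb al * (-1) ^+ H).
Definition poly_value (g : {poly K}) : K := value_lead ^+ (size g).-1 * poly_value0 g.
Definition poly_char0 (g : {poly F}) : algC := tau (poly_value0 g^e ^+ M).
Definition poly_char (g : {poly F}) : algC := tau (poly_value g^e ^+ M).

Lemma poly_value0M g h : poly_value0 (g * h) = poly_value0 g * poly_value0 h.
Proof.
rewrite /poly_value0 hornerM exprMn invfM mulrACA -big_split; congr (_ * _).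
by apply: eq_bigr => v _; rewrite hornerM.
Qed.

Lemma poly_valueM g h : g \is monic -> h \is monic -> poly_value (g * h) = poly_value g * poly_value h.
Proof.
move=> mg mh; rewrite /poly_value poly_value0M [RHS]mulrACA -exprD; congr (_ ^+ _ * _).
rewrite size_mul ?monic_neq0 //.
have : (0 < size g)%N by rewrite size_poly_gt0 monic_neq0.
have : (0 < size h)%N by rewrite size_poly_gt0 monic_neq0.
by case: (size g) (size h) => // a [] // b _ _; rewrite addSn addnS.
Qed.

Lemma root_feE v : root f^e v = (v \in V).
Proof. by rewrite fV rootZ ?root_prod_XsubC // fmorph_eq0 lead_coef_eq0. Qed.

(** Frobenius permutes the roots [V], since [f] has coefficients in [F]. *)
Lemma poly_value0_fix (g : {poly F}) : poly_value0 g^e ^+ Q = poly_value0 g^e.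
Proof.
have frob x : (g^e).[x ^+ Q] = (g^e).[x] ^+ Q.
  by have := horner_frob emb pQ g 1 x; rewrite !expn1.
rewrite /poly_value0 expr_div_n exprAC -frob expr0n gtn_eqF; last exact/ltnW/card_gt1.
congr (_ / _); rewrite -prodrXl.
rewrite (eq_bigr (fun v => (g^e).[v ^+ Q])) => [|v _]; last by rewrite frob.
rewrite -(big_map (fun v => v ^+ Q) xpredT (fun v => (g^e).[v])).
apply: perm_big; rewrite perm_sym.
have uV' : uniq [seq v ^+ Q | v <- V].
  by rewrite map_inj_uniq // => x y; have := @frob_inj _ _ pQ 1 x y; rewrite expn1.
have sV : {subset [seq v ^+ Q | v <- V] <= V}.
  move=> _ /mapP [v vV ->]; rewrite -root_feE /root.
  have := horner_frob emb pQ f 1 v; rewrite expn1 => ->.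
  by move: vV; rewrite -root_feE /root => /eqP ->; rewrite expr0n gtn_eqF // ltnW ?card_gt1.
have [|_ E] := uniq_min_size uV' sV; first by rewrite size_map.
by apply: uniq_perm => //.
Qed.

Lemma value_lead_fix : value_lead ^+ Q = value_lead.
Proof.
have -> : value_lead = emb (lead_coef f * (-1) ^+ size V / (al * (-1) ^+ H)).
  by rewrite fmorph_div !rmorphM !rmorphXn !rmorphN1.
exact: emb_fix.
Qed.

Lemma value_lead_neq0 : value_lead != 0.
Proof.
by rewrite !mulf_neq0 ?invr_eq0 ?mulf_neq0 ?fmorph_eq0 ?lead_coef_eq0 ?signr_eq0.
Qed.

Lemma value_leadX_fix (e : nat) : (value_lead ^+ e) ^+ Q = value_lead ^+ e.
Proof. by rewrite exprAC value_lead_fix. Qed.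

(** Isolates the factor that depends only on the degree; the rest sees [g] only modulo [f]. *)
Lemma poly_charE (g : {poly F}) e : size g = e.+1 -> poly_char g = tau ((value_lead ^+ e) ^+ M) * poly_char0 g.
Proof.
move=> sg; rewrite /poly_char /poly_value size_map_poly sg /= tau_expM ?value_leadX_fix //.
exact: poly_value0_fix.
Qed.

Lemma poly_value_fix (g : {poly F}) : poly_value g^e ^+ Q = poly_value g^e.
Proof. by rewrite /poly_value exprMn value_leadX_fix poly_value0_fix. Qed.

Lemma poly_charM : {in monic &, {morph poly_char : g h / g * h}}.
Proof.
move=> g h mg mh; rewrite /poly_char rmorphM poly_valueM ?map_monic //.
by rewrite tau_expM ?poly_value_fix.
Qed.

Lemma poly_value_XsubC x : poly_value ('X - x%:P) = kummer_value emb f al H x.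
Proof.
rewrite /poly_value size_XsubC /= expr1 /kummer_value fV hornerZ horner_prod /poly_value0 /value_lead.
rewrite hornerXsubC sub0r (exprNn x).
have -> : \prod_(v <- V) ('X - x%:P).[v] = (-1) ^+ size V * \prod_(v <- V) ('X - v%:P).[x].
  elim: (V) => [|v W IH]; first by rewrite !big_nil mulr1.
  by rewrite !big_cons IH !hornerXsubC exprS; ring.
have s1 n : (-1) ^+ n * (-1) ^+ n = 1 :> K by rewrite -exprD addnn -mul2n exprM sqrrN expr1n expr1n.
rewrite !invfM; have -> : ((-1) ^+ H)^-1 = (-1) ^+ H :> K by rewrite -exprVn invrN1.
set P := \prod_(v <- V) _; set a := emb _; set c := (emb al)^-1.
transitivity (a * P * (c / x ^+ H) * (((-1) ^+ size V * (-1) ^+ size V) * ((-1) ^+ H * (-1) ^+ H))).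
  by ring.
by rewrite !s1 !mulr1.
Qed.

(** By multiplicativity the left side is a power of the product of the conjugates of
    [kummer_value th], that is, of its norm. *)
Lemma poly_value_conj_poly i (th : K) : (0 < i)%N -> th ^+ (Q ^ i) = th ->
  poly_value (conj_poly F i th) ^+ M = kummer_value emb f al H th ^+ ((Q ^ i).-1 %/ s).
Proof.
move=> i0 thQ.
have kvQ x j : kummer_value emb f al H (x ^+ (Q ^ j)) = kummer_value emb f al H x ^+ (Q ^ j).
  rewrite /kummer_value horner_frob // expr_div_n exprMn exprAC; congr (_ / (_ * _)).
  elim: j => [|j IH]; first by rewrite expr1.
  by rewrite expnSr exprM -IH emb_fix.
have -> : poly_value (conj_poly F i th) = kummer_value emb f al H th ^+ (\sum_(j < i) Q ^ j).
  elim: {i0 thQ} i => [|i IH].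
    rewrite /conj_poly !big_ord0 /poly_value size_poly1 mul1r /poly_value0 hornerC expr1n invr1 mulr1.
    by rewrite big1 // => v _; rewrite hornerC.
  rewrite /conj_poly !big_ord_recr /= -/(conj_poly F i th) poly_valueM ?conj_poly_monic ?monicXsubC //.
  by rewrite IH poly_value_XsubC kvQ exprD.
rewrite -exprM; congr (_ ^+ _).
by rewrite predn_exp mulnC divn_mulAC //.
Qed.

Lemma poly_char_conj_poly i th : (0 < i)%N -> th \in ext_points F K i ->
  poly_char (descend emb (conj_poly F i th)) = tau (kummer_value emb f al H th ^+ ((Q ^ i).-1 %/ s)).
Proof.
by move=> i0; rewrite mem_ext_points // => /eqP thQ; rewrite /poly_char conj_poly_fix // poly_value_conj_poly.
Qed.

(* Multiplying the remainder mod [f] by [u] permutes the monic polynomials of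
   a given degree >= deg f, which is why the character sum over them vanishes. *)
Definition twist (u g : {poly F}) : {poly F} := (g %/ f) * f + (u * g) %% f.

(** Twisting is injective because it keeps the quotient and [u] is invertible modulo [f]; as
    [deg f <= e], changing the remainder leaves the leading term alone. *)
Lemma twist_monics u e : (size V <= e)%N -> coprimep u f ->
  perm_eq [seq twist u g | g <- monics F e] (monics F e).
Proof.
move=> Ve uf.
have sf : size f = (size V).+1.
  by rewrite -(size_map_poly emb) fV size_scale ?size_prod_XsubC // fmorph_eq0 lead_coef_eq0.
have injt : injective (twist u).
  move=> g h E.
  have qe : g %/ f = h %/ f.
    have := congr1 (fun p => p %/ f) E; rewrite /twist !divp_addl_mul_small ?ltn_modp //.
  have : (u * g) %% f = (u * h) %% f.
    by move: E; rewrite /twist qe => /addrI.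
  move/eqP; rewrite -subr_eq0 -modpN -modpD -mulrBr.
  rewrite -[_ == 0]/(f %| _) Gauss_dvdpr 1?coprimep_sym // /dvdp modpD modpN subr_eq0.
  by move=> /eqP re; rewrite (divp_eq g f) qe re -divp_eq.
have um : uniq [seq twist u g | g <- monics F e] by rewrite map_inj_uniq ?monics_uniq.
have sub : {subset [seq twist u g | g <- monics F e] <= monics F e}.
  move=> _ /mapP [g + ->]; rewrite !mem_monics => /andP [mg /eqP sg].
  have -> : twist u g = g + ((u * g) %% f - g %% f).
    by rewrite [X in _ = X + _](divp_eq g f) /twist; ring.
  have sm : (size ((u * g) %% f - g %% f)%R < size g)%N.
    rewrite sg ltnS; apply: leq_trans Ve; rewrite -ltnS -sf.
    apply: leq_ltn_trans (size_polyD _ _) _.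
    by rewrite gtn_max size_polyN !ltn_modp f0.
  by rewrite monicE lead_coefDl // size_polyDl // sg eqxx andbT.
have [|_ E] := uniq_min_size um sub; first by rewrite (size_map (twist u)).
exact: uniq_perm (monics_uniq _ _) E.
Qed.

Lemma poly_value0_twist u g : poly_value0 (twist u g)^e = poly_value0 u^e * poly_value0 g^e.
Proof.
rewrite -poly_value0M -rmorphM.
have hv v : v \in V -> ((twist u g)^e).[v] = ((u * g)^e).[v].
  rewrite -root_feE /root => /eqP fv0.
  rewrite /twist {2}(divp_eq (u * g) f) !rmorphD !rmorphM !hornerD !hornerM.
  by rewrite fv0 !mulr0.
rewrite /poly_value0 hv //; congr (_ / _); exact: eq_big_seq.
Qed.

Lemma poly_value0_neq0_coprime (u : {poly F}) : poly_value0 u^e != 0 -> coprimep u f.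
Proof.
rewrite /poly_value0 mulf_eq0 negb_or => /andP [H1 _].
rewrite -(coprimep_map emb) fV coprimepZr ?fmorph_eq0 ?lead_coef_eq0 //.
rewrite coprimep_sym; have := H1; rewrite prodf_seq_neq0 => /allP /= Hv.
elim: (V) Hv => [|v W IH] Hv; first by rewrite big_nil coprime1p.
rewrite big_cons coprimepMl IH ?andbT; last by move=> x xW; apply: Hv; rewrite inE xW orbT.
by rewrite coprimep_sym coprimep_XsubC; apply: Hv; rewrite inE eqxx.
Qed.

(** One of two distinct roots is nonzero. It must be, since the denominator [al X ^ H] may not
    vanish where Stepanov's argument measures orders. *)
Lemma simple_root : exists v h, [/\ v != 0, f^e = ('X - v%:P) * h & h.[v] != 0].
Proof.
have [v vV v0] : exists2 v, v \in V & v != 0.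
  case: V V2 uV => [|x [|y W]] // _ /= /andP [].
  rewrite inE negb_or => /andP [xy _] _; have [x0|x0] := eqVneq x 0.
    by exists y; rewrite ?inE ?eqxx ?orbT // -x0 eq_sym.
  by exists x; rewrite ?inE ?eqxx.
exists v, (emb (lead_coef f) *: \prod_(x <- rem v V) ('X - x%:P)); split=> //.
  by rewrite fV (big_rem v) //= scalerAr.
rewrite hornerZ mulf_neq0 ?fmorph_eq0 ?lead_coef_eq0 // horner_prod prodf_seq_neq0.
apply/allP => x; rewrite mem_rem_uniq // inE => /andP [xv _] /=.
by rewrite hornerXsubC subr_eq0 eq_sym.
Qed.

Local Notation ksum := (kummer_sum emb f al H s tau).
Local Notation G := (size f + H)%N.

Lemma ksum_even : exists C : nat, forall u, (0 < u)%N -> `|ksum (2 * u)| <= (C * Q ^ u)%:R.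
Proof.
have [v [h [v0 fE hv]]] := simple_root.
apply: (kummer_sum_even pQ Q4 s0 sQ al0 (G := G) _ _ fE hv v0 tau0 taule umu mumem szmu summu).
- by rewrite leqW // leq_addr.
- exact: leq_addl.
Qed.

Lemma nontrivial_poly_char0 : exists2 u : {poly F}, coprimep u f & poly_char0 u != 1.
Proof.
(* Otherwise every nonzero term of [ksum (2 * u)] would have the same value of
   absolute value 1, against [ksum_even]. *)
have [C HC] := ksum_even; pose u0 := (C + G + 3)%N; pose i := (2 * u0)%N.
have u00 : (0 < u0)%N by rewrite /u0 addn3.
have i0 : (0 < i)%N by rewrite muln_gt0.
pose kv := kummer_value emb f al H; pose n th := descend emb (conj_poly F i th).
have [/hasP [th thi /andP [w0 l1]]|/hasPn none] :=
  boolP (has (fun th => (kv th != 0) && (poly_char0 (n th) != 1)) (ext_points F K i)).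
  exists (n th) => //; apply: poly_value0_neq0_coprime.
  have : poly_value (n th)^e ^+ M != 0.
    move: thi; rewrite mem_ext_points // => /eqP thQ.
    by rewrite conj_poly_fix // poly_value_conj_poly // expf_neq0.
  by rewrite expf_eq0 M_gt0 /= /poly_value mulf_eq0 negb_or => /andP [].
have [v [h [v0 fE hv]]] := simple_root.
have sfG : (size f <= G.+1)%N by rewrite leqW // leq_addr.
have N := count_kummer_neq0 pQ H al0 sfG fE hv i0.
rewrite -/kv in N; set c := count _ _ in N.
have SE : ksum i = tau ((value_lead ^+ i) ^+ M) * c%:R.
  rewrite /kummer_sum /c -sum1_count natr_sum mulr_sumr [RHS]big_mkcond.
  apply: eq_big_seq => th thi /=; have [w0|w0] := eqVneq (kv th) 0.
    rewrite -/(kv th) w0 expr0n gtn_eqF ?tau0 //.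
    rewrite divn_gt0 // dvdn_leq ?dvdn_expQ_pred //.
    by rewrite -ltnS expQ_gt_pred expQ_gt1.
  rewrite -poly_char_conj_poly // mulr1; move: (thi); rewrite mem_ext_points // => /eqP thQ.
  have [_ sn] := descend_conj_monic emb pQ i0 thQ.
  rewrite (poly_charE sn); have := none _ thi; rewrite w0 /= negbK => /eqP ->.
  by rewrite mulr1.
have := HC _ u00; rewrite SE normrM norm_tau_expM ?value_leadX_fix ?expf_neq0 ?value_lead_neq0 // mul1r.
rewrite normr_nat ler_nat => cC.
(* This reads [Q ^ (2 * u0) <= C * Q ^ u0 + G.+1], whereas [u0] was chosen to make [Q ^ u0] larger
   than [C + G.+1]. *)
have := leq_trans N (leq_add cC (leqnn _)).
have -> : (Q ^ i = Q ^ u0 * Q ^ u0)%N by rewrite /i mulnC expnM expnS expn1.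
have : (u0 < Q ^ u0)%N by rewrite ltn_expl // card_gt1.
set X := (Q ^ u0)%N; rewrite /u0 => hX hle; exfalso.
have X0 : (0 < X)%N by exact: leq_ltn_trans hX.
have XC : (C + G.+1 < X)%N by apply: ltn_trans hX; rewrite addnS addn3 !ltnS.
have : (X * X <= C * X + G.+1 * X)%N.
  by apply: leq_trans hle _; rewrite leq_add2l leq_pmulr.
by rewrite -mulnDl leq_mul2r gtn_eqF //= leqNgt XC.
Qed.

Lemma sum_poly_char_eq0 e : (size V <= e)%N -> \sum_(g <- monics F e) poly_char g = 0.
Proof.
move=> Ve; have [u uf l1] := nontrivial_poly_char0.
have E : \sum_(g <- monics F e) poly_char g = poly_char0 u * \sum_(g <- monics F e) poly_char g.
  rewrite -{1}(perm_big _ (twist_monics Ve uf)) big_map mulr_sumr /=.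
  apply: eq_big_seq => g gm; have := gm; rewrite mem_monics => /andP [_ /eqP sg].
  have : twist u g \in monics F e by rewrite -(perm_mem (twist_monics Ve uf)) map_f.
  rewrite mem_monics => /andP [_ /eqP st]; rewrite (poly_charE sg) (poly_charE st) mulrCA; congr (_ * _).
  by rewrite /poly_char0 poly_value0_twist tau_expM ?poly_value0_fix.
apply/eqP; move/eqP: E; rewrite -subr_eq0 -{1}[\sum_(g <- _) _]mul1r -mulrBl mulf_eq0.
by rewrite subr_eq0 eq_sym (negPf l1).
Qed.

Lemma monics0 : perm_eq (monics F 0) [:: 1].
Proof.
apply: uniq_perm => // [|g]; first exact: monics_uniq.
rewrite mem_monics inE; apply/andP/eqP => [[mg /eqP sg]|->].
  by have := monicP mg; rewrite lead_coefE sg /= (size1_polyC (eq_leq sg)) coefC eqxx => ->.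
by rewrite monic1 size_poly1.
Qed.

Theorem weil_bound : `|ksum 1| <= (size V).-1%:R * sqrtC Q%:R.
Proof.
pose c e := \sum_(g <- monics F e) poly_char g.
have c0 : c 0%N = 1.
  rewrite /c (perm_big _ monics0) big_seq1 /poly_char /poly_value rmorph1 size_poly1 mul1r /poly_value0 hornerC expr1n.
  by rewrite big1 ?invr1 ?mulr1 ?expr1n // => v _; rewrite hornerC.
pose L := \poly_(e < size V) c e.
have LE e : L`_e = c e by rewrite coef_poly; case: ltnP => // Ve; rewrite /c sum_poly_char_eq0.
have [om LO so] : exists2 om : seq algC, L = \prod_(w <- om) (1 - w *: 'X) & size om = (size L).-1.
  by apply: unit_poly_factor; rewrite LE.
(* Both sides solve the Newton recursion of the coefficients of [L], one by the Euler product and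
   the other by the factorization. *)
have key i : ksum i.+1 = - \sum_(w <- om) w ^+ i.+1.
  have := @newton_unique algC c (fun i => ksum i) (fun i => - \sum_(w <- om) w ^+ i) c0 _ _ i.
  apply => n; last first.
    by have /= := newton_power_sums om n; rewrite -LO LE => ->; rewrite -sumrN;
      apply: eq_bigr => j _; rewrite LE mulNr.
  rewrite /c (euler_convolution emb pQ n poly_charM); apply: eq_bigr => j _; congr (_ * _).
  by apply: eq_big_seq => th thj; exact: poly_char_conj_poly.
have [C HC] := ksum_even.
(* Estimates exist only for even degrees, so the squares of the roots are bounded, by [Q]. *)
have omQ : {in om, forall w, `|w| <= sqrtC Q%:R}.
  move=> w wom; rewrite -(ler_pXn2r (n := 2)) ?nnegrE ?normr_ge0 ?sqrtC_ge0 ?ler0n // sqrtCK -normrX.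
  apply: (@power_sum_bound [seq z ^+ 2 | z <- om] C%:R Q%:R); last exact: map_f.
    by rewrite ltr0n ltnW ?card_gt1.
  move=> u; rewrite big_map.
  have -> : \sum_(z <- om) (z ^+ 2) ^+ u.+1 = - ksum (2 * u.+1).
    have -> : (2 * u.+1 = (2 * u).+1.+1)%N by rewrite mulnS.
    rewrite key opprK; apply: eq_bigr => z _; rewrite -exprM; congr (_ ^+ _); lia.
  by rewrite normrN -natrX -natrM; exact: HC.
rewrite key normrN; apply: le_trans (ler_norm_sum _ _ _) _.
apply: (@le_trans _ _ (\sum_(w <- om) sqrtC Q%:R)).
  by rewrite big_seq [leRHS]big_seq; apply: ler_sum => w wom; rewrite expr1; exact: omQ.
rewrite big_const_seq iter_addr_0 count_predT -[leLHS]mulr_natl ler_wpM2r ?sqrtC_ge0 ?ler0n //.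
rewrite ler_nat so; have := size_poly (size V) c; rewrite -/L; lia.
Qed.

End Weil.

(** * Points on Kummer curves *)

Lemma expf_card_pred (F : finFieldType) (x : F) : x != 0 -> x ^+ #|F|.-1 = 1.
Proof.
move=> x0; apply: (mulfI x0); rewrite -exprS prednK ?expf_card ?mulr1 //.
exact/ltnW/finNzRing_gt1.
Qed.

Lemma finField_prim_root (F : finFieldType) : exists g : F, #|F|.-1.-primitive_root g.
Proof.
pose rs := enum (predC1 (0 : F)).
have srs : size rs = #|F|.-1 by rewrite -cardE cardC1.
have F1 := finNzRing_gt1 F.
have /hasP [g _ gP] : has #|F|.-1.-primitive_root rs; last by exists g.
apply: has_prim_root; rewrite ?srs ?enum_uniq //; first by rewrite -ltnS prednK // ltnW.
apply/allP => x; rewrite mem_enum inE => x0; rewrite unity_rootE.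
exact/eqP/expf_card_pred.
Qed.

(** In terms of a generator, the hypothesis makes the exponent of [w] a multiple of [s], and Bezout
    writes [s] as a multiple of [m] modulo [#|F|.-1]. *)
Lemma finField_root (F : finFieldType) (m s : nat) (w : F) : (0 < m)%N ->
  s = gcdn m #|F|.-1 -> w ^+ (#|F|.-1 %/ s) = 1 -> exists2 x, x != 0 & x ^+ m = w.
Proof.
move=> m0 sE ws; have [g gP] := finField_prim_root F.
have Q0 := prim_order_gt0 gP.
have sQ : (s %| #|F|.-1)%N by rewrite sE dvdn_gcdr.
have s0 : (0 < s)%N by rewrite sE gcdn_gt0 m0.
have g0 : g != 0.
  apply: contra_eq_neq (prim_expr_order gP) => ->.
  by rewrite expr0n gtn_eqF // eq_sym oner_eq0.
have [[e _] /= we] : {i : 'I_#|F|.-1 | w = g ^+ i}.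
  by apply: (prim_rootP gP); rewrite -(divnK sQ) exprM ws expr1n.
have se : (s %| e)%N.
  have : (#|F|.-1 %| e * (#|F|.-1 %/ s))%N.
    by rewrite (prim_order_dvd gP) exprM -we ws.
  by rewrite -{1}(divnK sQ) mulnC dvdn_pmul2r // divn_gt0 // dvdn_leq.
have [km kn H _] := egcdnP #|F|.-1 m0.
exists (g ^+ (e %/ s * km)); first by rewrite expf_neq0.
rewrite -exprM -mulnA H -sE mulnDr mulnA exprD exprM exprAC (prim_expr_order gP) expr1n mul1r.
by rewrite divnK.
Qed.

(** * Characters of the group of s-th roots of unity *)

Section RootOfUnityCharacter.

Variables (K : fieldType) (s : nat) (z : K) (zeta : algC).
Hypotheses (s0 : (0 < s)%N) (zP : s.-primitive_root z) (zetaP : s.-primitive_root zeta).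

Definition unity_seq : seq K := [seq z ^+ i | i <- iota 0 s].

Lemma mem_unity_seq x : (x \in unity_seq) = (x ^+ s == 1).
Proof.
apply/mapP/eqP => [[i _ ->]|/(prim_rootP zP) [[i li] /= ->]].
  by rewrite exprAC (prim_expr_order zP) expr1n.
by exists i => //; rewrite mem_iota add0n.
Qed.

Lemma uniq_unity_seq : uniq unity_seq.
Proof.
rewrite map_inj_in_uniq ?iota_uniq // => i j; rewrite !mem_iota !add0n /= => li lj.
by move/eqP; rewrite (eq_prim_root_expr zP) !modn_small // => /eqP.
Qed.

Lemma size_unity_seq : size unity_seq = s.
Proof. by rewrite size_map size_iota. Qed.

(** The index of [x] is its discrete logarithm to base [z]; [c] runs over the [s] characters, and
    [c = 0] is the trivial one. *)
Definition unity_char c x : algC :=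
  if x \in unity_seq then zeta ^+ (c * index x unity_seq) else 0.

Lemma unity_charX c i : unity_char c (z ^+ i) = zeta ^+ (c * i).
Proof.
rewrite /unity_char mem_unity_seq exprAC (prim_expr_order zP) expr1n eqxx.
have -> : z ^+ i = nth 0 unity_seq (i %% s).
  by rewrite (nth_map 0%N) ?size_iota ?nth_iota ?add0n ?ltn_mod // (prim_expr_mod zP).
rewrite index_uniq ?uniq_unity_seq ?size_unity_seq ?ltn_mod //.
by apply/eqP; rewrite (eq_prim_root_expr zetaP) modnMmr.
Qed.

Lemma unity_char0 c : unity_char c 0 = 0.
Proof.
by rewrite /unity_char mem_unity_seq expr0n gtn_eqF // eq_sym oner_eq0.
Qed.

Lemma unity_char1 c : unity_char c 1 = 1.
Proof. by rewrite -[X in unity_char _ X](expr0 z) unity_charX muln0. Qed.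

Lemma unity_charM c x y : x ^+ s = 1 -> y ^+ s = 1 ->
  unity_char c (x * y) = unity_char c x * unity_char c y.
Proof.
move=> /(prim_rootP zP) [i ->] /(prim_rootP zP) [j ->].
by rewrite -exprD !unity_charX mulnDr exprD.
Qed.

Lemma unity_char_le1 c x : `|unity_char c x| <= 1.
Proof.
rewrite /unity_char; case: ifP => _; last by rewrite normr0.
rewrite normrX; have /eqP -> : `|zeta| == 1; last by rewrite expr1n.
by rewrite -(pexpr_eq1 s0) // -normrX (prim_expr_order zetaP) normr1.
Qed.

Lemma sum_geom_eq0 (w : algC) : w ^+ s = 1 -> w != 1 -> \sum_(i < s) w ^+ i = 0.
Proof.
move=> ws w1; have := subrX1 w s; rewrite ws subrr => /esym/eqP.
by rewrite mulf_eq0 subr_eq0 (negPf w1) => /eqP.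
Qed.

Lemma zeta_powX c : (zeta ^+ c) ^+ s = 1.
Proof. by rewrite exprAC (prim_expr_order zetaP) expr1n. Qed.

Lemma zeta_pow_neq1 c : (0 < c < s)%N -> zeta ^+ c != 1.
Proof.
case/andP => c0 cs; rewrite -(prim_order_dvd zetaP).
by apply: contraL cs => /(dvdn_leq c0); rewrite -leqNgt.
Qed.

Lemma sum_unity_char c : (0 < c < s)%N -> \sum_(x <- unity_seq) unity_char c x = 0.
Proof.
move=> cs; rewrite big_map -[iota 0 s]/(iota 0 s) -{1}[s]subn0 big_mkord.
rewrite -[RHS](sum_geom_eq0 (zeta_powX c) (zeta_pow_neq1 cs)); apply: eq_bigr => i _.
by rewrite unity_charX exprM.
Qed.

Lemma unity_char_orthogonal x : x ^+ s = 1 -> x != 1 -> \sum_(c < s) unity_char c x = 0.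
Proof.
move=> /(prim_rootP zP) [[i li] /= ->] x1.
have i0 : (0 < i)%N by rewrite lt0n; apply: contraNneq x1 => ->.
rewrite -[RHS](sum_geom_eq0 (zeta_powX i) (@zeta_pow_neq1 i _)) ?i0 //.
by apply: eq_bigr => c _; rewrite unity_charX -exprM mulnC.
Qed.

End RootOfUnityCharacter.

(** Let [n = deg f]. Without such a [y] the [s] character sums add up to 0, yet the trivial one is
    at least [#|F| - (n + 1)] and the others total at most [(s - 1) (n - 1) sqrt #|F|]. Since [(s -
    1) (n - 1) + 2 n <= (s + 1) n <= sqrt #|F|], this is impossible. *)
Theorem kummer_point (F : finFieldType) (f : {poly F}) (al : F) (H s : nat) :
  (exists2 p, p \in [pchar F] & p.-nat #|F|) ->
  (4 <= #|F|)%N -> (0 < s)%N -> (s %| #|F|.-1)%N -> al != 0 ->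
  separable_poly f -> f.[0] = 0 -> (3 <= size f)%N ->
  ((s.+1 * (size f).-1) ^ 2 <= #|F|)%N ->
  exists y, [/\ y != 0, f.[y] != 0 & (f.[y] / (al * y ^+ H)) ^+ (#|F|.-1 %/ s) = 1].
Proof.
move=> [p pF pQ] Q4 s0 sQ al0 sepf f00 sf3 big.
have [K [emb _]] := countable_algebraic_closure F.
have pQK : [pchar K].-nat #|F|.
  by apply: sub_in_pnat pQ => r _; rewrite inE => /eqP ->; exact: rmorph_pchar emb _ pF.
pose M := (#|F|.-1 %/ s)%N.
have M0 : (0 < M)%N by exact: M_gt0.
have [V fV] := closed_field_poly_normal (map_poly emb f).
rewrite lead_coef_map in fV.
have f0 : f != 0 by rewrite -size_poly_eq0; case: (size f) sf3.
have lf0 : emb (lead_coef f) != 0 by rewrite fmorph_eq0 lead_coef_eq0.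
have sV : size f = (size V).+1.
  by rewrite -(size_map_poly emb) fV size_scale ?size_prod_XsubC.
have uV : uniq V.
  rewrite -separable_prod_XsubC; move: sepf; rewrite -(separable_map emb) fV.
  by rewrite -mul_polyC separable_mul => /and3P [].
have V0 : 0 \in V.
  by rewrite -root_prod_XsubC -(rootZ _ _ lf0) -fV -(rmorph0 emb) fmorph_root /root f00.
have V2 : (2 <= size V)%N by rewrite -ltnS -sV.
have [g gP] := finField_prim_root F.
pose z := emb (g ^+ M).
have zP : s.-primitive_root z by rewrite fmorph_primitive_root; exact: (dvdn_prim_root gP sQ).
have [zeta zetaP] := C_prim_root_exists s0.
pose tau := unity_char s z zeta; pose mu := unity_seq s z.
pose kv := kummer_value emb f al H.
have [/existsP [y /and3P [y0 fy0 /eqP yM]]|] :=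
  boolP [exists y, [&& y != 0, f.[y] != 0 & (f.[y] / (al * y ^+ H)) ^+ M == 1]].
  by exists y.
rewrite negb_exists => /forallP none; exfalso.
have kvE y : kv (emb y) = emb (f.[y] / (al * y ^+ H)).
  by rewrite /kv /kummer_value horner_map fmorph_div rmorphM rmorphXn.
pose N := count (fun th => kv th != 0) (ext_points F K 1).
(* Each point contributes 0: its value is 0, or the relevant power is an s-th root of unity other
   than 1 and the characters cancel. *)
have sum0 : \sum_(c < s) kummer_sum emb f al H s (tau c) 1 = 0.
  rewrite /kummer_sum exchange_big big1_seq // => th /andP [_ thi] /=; rewrite expn1.
  have [y yE] : exists y, emb y = th.
    by apply: (frob_fixed emb); move: thi; rewrite mem_ext_points // expn1 => /eqP.
  rewrite -yE -/(kv _) kvE -rmorphXn -/M.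
  have [w0|w0] := eqVneq (f.[y] / (al * y ^+ H)) 0.
    by rewrite big1 // => c _; rewrite w0 expr0n gtn_eqF // rmorph0 /tau unity_char0.
  apply: (unity_char_orthogonal s0 zP zetaP).
    by rewrite -rmorphXn -exprM divnK // expf_card_pred // rmorph1.
  have := none y; rewrite fmorph_eq1 !negb_and !negbK.
  have fy0 : f.[y] != 0 by apply: contraNneq w0 => ->; rewrite mul0r.
  by case: eqVneq => [y0|_] /=; [rewrite y0 f00 eqxx in fy0|rewrite (negPf fy0)].
have ksum0 : kummer_sum emb f al H s (tau 0) 1 = N%:R.
  rewrite /kummer_sum /N -sum1_count natr_sum [RHS]big_mkcond; apply: eq_big_seq => th thi /=.
  have [w0|w0] := eqVneq (kv th) 0.
    by rewrite -/(kv th) w0 expr0n expn1 gtn_eqF // /tau unity_char0.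
  have := kummer_value_pow_mu pQK sQ (mem_unity_seq zP) (ltn0Sn 0) thi w0.
  by rewrite /tau /unity_char => ->; rewrite mul0n.
have [v [h [v0 fE hv]]] := simple_root fV uV V2 f0.
have Nge : (#|F| <= N + size f)%N.
  have sfG : (size f <= (size V).+1)%N by rewrite sV.
  have := count_kummer_neq0 pQK H al0 sfG fE hv (ltn0Sn 0).
  by rewrite expn1 sV; apply: leq_trans; rewrite leqnn.
have wb c : (0 < c < s)%N -> `|kummer_sum emb f al H s (tau c) 1| <= (size V).-1%:R * sqrtC #|F|%:R.
  move=> cs; apply: (@weil_bound F K emb pQK f al H s V Q4 s0 sQ al0 fV uV V0 V2 f0 (tau c) mu).
  - exact: unity_char0.
  - exact: (unity_char1 s0 zP zetaP).
  - by move=> x; exact: (@unity_char_le1 K s z zeta).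
  - by move=> x y; exact: unity_charM.
  - exact: uniq_unity_seq.
  - exact: mem_unity_seq.
  - exact: size_unity_seq.
  - exact: (sum_unity_char s0 zP zetaP cs).
pose r : algC := sqrtC #|F|%:R; pose n := size V.
have rr : r ^+ 2 = #|F|%:R by rewrite sqrtCK.
have r0 : 0 <= r by rewrite sqrtC_ge0 ler0n.
have rge : (s.+1 * n)%:R <= r.
  rewrite -(ler_pXn2r (n := 2)) ?nnegrE ?ler0n // rr -natrX ler_nat.
  by move: big; rewrite sV.
have Nle : N%:R <= s.-1%:R * (n.-1%:R * r).
  have NE : N%:R = - \sum_(1 <= c < s) kummer_sum emb f al H s (tau c) 1 :> algC.
    apply/eqP; rewrite -addr_eq0 -ksum0 -[X in _ == X]sum0.
    by rewrite -(big_mkord xpredT (fun c => kummer_sum emb f al H s (tau c) 1)) big_ltn.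
  rewrite -(normr_nat _ N) NE normrN.
  apply: le_trans (ler_norm_sum _ _ _) _.
  apply: (@le_trans _ _ (\sum_(1 <= c < s) (n.-1%:R * r))).
    rewrite big_nat [leRHS]big_nat; apply: ler_sum => c cs; exact: wb.
  by rewrite sumr_const_nat subn1 -[leLHS]mulr_natl.
have : #|F|%:R <= s.-1%:R * (n.-1%:R * r) + n.+1%:R.
  apply: (@le_trans _ _ (N%:R + n.+1%:R)); last by rewrite lerD2r.
  by rewrite -natrD ler_nat -sV.
rewrite -rr mulrA -natrM => bd.
have An : (s.-1 * n.-1 + 2 * n <= s.+1 * n)%N.
  have -> : s.+1 = (s.-1 + 2)%N by rewrite addn2 prednK.
  by rewrite mulnDl leq_add2r leq_mul // leq_pred.
have : (2 * n)%:R * r <= n.+1%:R.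
  rewrite -(lerD2l ((s.-1 * n.-1)%:R * r)); apply: le_trans bd.
  rewrite -mulrDl -natrD expr2 ler_wpM2r //; apply: le_trans rge.
  by rewrite ler_nat.
apply/negP; rewrite -real_ltNge ?ger0_real ?mulr_ge0 ?ler0n //.
apply: (@lt_le_trans _ _ ((2 * n)%:R * (s.+1 * n)%:R)); last by rewrite ler_wpM2l ?ler0n.
rewrite -natrM ltr_nat; have n2 : (2 <= n)%N by [].
have : (2 * n <= s.+1 * n)%N by rewrite leq_mul2r ltnS s0 orbT.
by move=> /(leq_mul (leqnn (2 * n)%N)); apply: leq_trans; clear -n2; nia.
Qed.

(** * Linear sets *)

Lemma ell_coef_neq0 (F : fieldType) d (a : nat -> F) : a d != 0 -> a (ell d a) != 0.
Proof.
move=> ad; have hd : has (fun i => a i != 0) (iota 0 d.+1).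
  by apply/hasP; exists d; rewrite // mem_iota /= add0n.
have := nth_find 0%N hd; rewrite nth_iota // -[X in (_ < X)%N](size_iota 0 d.+1).
by rewrite -has_find.
Qed.

Lemma coef_lt_ell (F : fieldType) d (a : nat -> F) i : (i < ell d a)%N -> (i <= d)%N -> a i = 0.
Proof.
move=> il id; have := before_find 0%N il.
by rewrite nth_iota ?add0n // => /negbFE /eqP.
Qed.

Lemma ell_le (F : fieldType) d (a : nat -> F) : a d != 0 -> (ell d a <= d)%N.
Proof. by move=> ad; rewrite leqNgt; apply/negP => /coef_lt_ell; rewrite leqnn => /(_ isT) /eqP; apply/negP. Qed.

Lemma ell_lt (F : fieldType) d (a : nat -> F) : a d != 0 -> (2 <= nsupp d a)%N -> (ell d a < d)%N.
Proof.
move=> ad n2; rewrite ltn_neqAle ell_le // andbT; apply: contraL n2 => /eqP ld.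
rewrite -leqNgt /nsupp -(cards1 (ord_max : 'I_d.+1)); apply/subset_leq_card/subsetP => i.
rewrite !inE -val_eqE /= => ai; rewrite eqn_leq -ltnS ltn_ord /= leqNgt.
by apply: contra ai => id; rewrite (@coef_lt_ell _ d) ?ld // ltnW.
Qed.

(** Provides a term besides the lowest one when the leading coefficient cancels against [beta]. *)
Lemma third_coef (F : fieldType) d (a : nat -> F) : a d != 0 -> (2 <= nsupp d a)%N ->
  nsupp d a <> 2%N -> exists i, [/\ (ell d a < i)%N, (i < d)%N & a i != 0].
Proof.
move=> ad n2 nn2; pose A := [set i : 'I_d.+1 | a i != 0].
have ld := ell_lt ad n2.
pose B := [set ord_max; inord (ell d a) : 'I_d.+1].
have : ~~ (A \subset B).
  apply/negP => /subset_leq_card; rewrite cards2 -/(nsupp d a) => h.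
  by apply: nn2; apply/eqP; rewrite eqn_leq n2 andbT; apply: leq_trans h _; case: (_ != _).
case/subsetPn => i; rewrite !inE negb_or => ai /andP [id il]; exists i.
rewrite ai; split=> //.
  rewrite ltn_neqAle; apply/andP; split.
    by apply: contra il => /eqP e; rewrite -val_eqE /= inordK -?e // ltnS ltnW.
  by rewrite leqNgt; apply: contra ai => lt; rewrite (coef_lt_ell lt) // -ltnS.
by rewrite ltn_neqAle -ltnS ltn_ord andbT; move: id; rewrite -val_eqE.
Qed.

Lemma le_ell3 (F : fieldType) d (a : nat -> F) i : (i < d)%N -> a i != 0 -> (i <= ell3 d a)%N.
Proof. by move=> id ai; exact: (@leq_bigmax_cond _ _ (fun i : 'I_d => i : nat) (Ordinal id)). Qed.

(** A point is determined by its slope [m], so it is enough to equate [g x / x] with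
    [f y / y ^+ (q ^ h)]. *)
Lemma span1_scale (F : finFieldType) (x t m : F) : x != 0 -> t != 0 ->
  span1 (x, x * m) = span1 (t, t * m).
Proof.
move=> x0 t0; apply/setP => v; apply/imsetP/imsetP => [] [c _ ->] /=.
  by exists (c * x / t) => //=; rewrite !mulrA !divfK.
by exists (c * t / x) => //=; rewrite !mulrA !divfK.
Qed.

Theorem theorem3p12 (F : finFieldType) (q n : nat)
  (Hq : prime_power q) (Hn : (2 <= n)%N) (HF : #|F| = (q ^ n)%N)
  (alpha beta : F) (k : nat) (Halpha : alpha != 0)
  (Hk1 : (1 <= k)%N) (Hkn : (k < n)%N)
  (a : nat -> F) (d : nat) (Hdn : (d < n)%N) (Had : a d != 0)
  (Ha0 : forall i, (d < i)%N -> a i = 0)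
  (Hnotmono : (2 <= nsupp d a)%N)
  (h : nat) (Hhn : (h < n)%N) (Hhl : (ell d a < h)%N)
  (Hbin : nsupp d a = 2%N -> h = d -> a h != beta) :
  let g := fun x : F => alpha * x ^+ (q ^ k) + beta * x in
  let f := linpoly q d a in
  let m_h := if (a d != beta) || (d != h) then maxn d h else ell3 d a in
  (2 * (k + m_h) <= n + 2 * ell d a)%N ->
  Lg g :&: Lf q h f != set0.
Proof.
move=> g f m Hm; set l := ell d a in Hhl Hm *.
have [p [e [pp [e0 qE]]]] := Hq.
have q2 : (2 <= q)%N by rewrite qE -(exp1n e) ltn_exp2r // prime_gt1.
have QE : #|F| = (p ^ (e * n))%N by rewrite HF qE expnM.
have pF : p \in [pchar F] by exact: card_finPcharP QE pp.
have ld : (l < d)%N by exact: ell_lt.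
(* These are the coefficients of [f y - beta * y ^+ (q ^ h)]: the one at [l] is untouched because
   [l < h], and none survives beyond [m]. *)
pose b i := a i - (if i == h then beta else 0).
have bl0 : b l != 0 by rewrite /b ltn_eqF // subr0 ell_coef_neq0.
have b_lt i : (i < l)%N -> b i = 0.
  move=> il; rewrite /b ltn_eqF ?subr0; last exact: ltn_trans Hhl.
  by apply: (coef_lt_ell il); rewrite ltnW // (ltn_trans il).
have b_gt i : (m < i)%N -> b i = 0.
  rewrite /m /b; case: ifPn => [_|].
    by rewrite gtn_max => /andP [di hi]; rewrite Ha0 // gtn_eqF // subr0.
  rewrite negb_or !negbK => /andP [/eqP adb /eqP dh] mi.
  have [->|ih] := eqVneq i h; first by rewrite -dh adb subrr.
  rewrite subr0; have [id|] := ltnP i d; last first.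
    by rewrite leq_eqVlt dh eq_sym (negPf ih) /= -dh; exact: Ha0.
  by apply/eqP; apply: contraTT mi => ai; rewrite -leqNgt le_ell3.
(* A second nonzero coefficient gives the shifted polynomial a nonzero root; [Hbin] is needed
   exactly when the leading term cancels. *)
have [j [lj jm bj]] : exists j, [/\ (l < j)%N, (j <= m)%N & b j != 0].
  suff [j lj bj] : exists2 j, (l < j)%N & b j != 0.
    by exists j; split=> //; rewrite leqNgt; apply: contra bj => /b_gt ->.
  have [dh|dh] := eqVneq d h; last by exists d; rewrite // /b (negPf dh) subr0.
  have [adb|adb] := eqVneq (a d) beta; last by exists d; rewrite // /b dh eqxx subr_eq0 -dh.
  have [|i [li id ai]] := third_coef Had Hnotmono.
    by move=> n2; have := Hbin n2 (esym dh); rewrite -dh adb eqxx.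
  by exists i; rewrite // /b -dh ltn_eqF // subr0.
have lm : (l < m)%N by exact: leq_trans lj jm.
pose D := (m - l)%N.
pose f1 : {poly F} := \sum_(i < D.+1) b (i + l)%N *: 'X^(q ^ i).
have qgt0 i : (0 < q ^ i)%N by rewrite expn_gt0 ltnW.
have f1E y : f1.[y ^+ (q ^ l)] = f y - beta * y ^+ (q ^ h).
  (* The range [N] contains [d], [h] and [m], so every sum involved extends to it by zeros. *)
  pose T i := b i * y ^+ (q ^ i); pose N := (d + h + m).+1.
  have -> : f1.[y ^+ (q ^ l)] = \sum_(l <= i < m.+1) T i.
    rewrite -[l in LHS]add0n -[X in \sum_(X <= _ < _) _]add0n big_addn big_mkord subSn 1?ltnW //.
    rewrite add0n horner_sum; apply: eq_bigr => i _.
    by rewrite hornerZ hornerXn -exprM -expnD addnC.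
  have -> : \sum_(l <= i < m.+1) T i = \sum_(0 <= i < N) T i.
    rewrite [RHS](big_cat_nat (n := l)) //=; last by rewrite /N; lia.
    rewrite [X in _ = X + _]big1_seq ?add0r; last first.
      by move=> i; rewrite mem_index_iota /= => il; rewrite /T b_lt ?mul0r.
    rewrite [RHS](big_cat_nat (n := m.+1)) //=; [|by lia|by rewrite /N; lia].
    rewrite [X in _ = _ + X]big1_seq ?addr0 // => i.
    by rewrite mem_index_iota /= => /andP [mi _]; rewrite /T b_gt ?mul0r.
  rewrite (eq_bigr (fun i => a i * y ^+ (q ^ i) - (if i == h then beta * y ^+ (q ^ i) else 0))); last first.
    by move=> i _; rewrite /T /b mulrBl; case: ifP => // _; rewrite mul0r.
  rewrite sumrB; congr (_ - _).
    rewrite (big_cat_nat (n := d.+1)) //=; last by rewrite /N; lia.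
    rewrite [X in _ + X]big1_seq ?addr0; first by rewrite big_mkord.
    by move=> i; rewrite mem_index_iota /= => /andP [di _]; rewrite Ha0 ?mul0r.
  rewrite (bigD1_seq h) ?iota_uniq //=; last by rewrite mem_index_iota /N; lia.
  by rewrite eqxx big1 ?addr0 // => i /negPf ->.
have natq i : (0 < i)%N -> (q ^ i)%:R = 0 :> F.
  move=> i0; apply/eqP; rewrite -(dvdn_pcharf pF) qE -expnM.
  by apply: dvdn_exp => //; rewrite muln_gt0 e0.
have df1 : f1^`() = (b l)%:P.
  rewrite /f1 big_ord_recl derivD derivZ expn0 derivX add0n raddf_sum big1 ?addr0 ?alg_polyC //.
  move=> i _; rewrite /= linearZ /= derivXn -scaler_nat natq // scale0r scaler0 //.
have sep : separable_poly f1.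
  by rewrite unlock df1 -alg_polyC coprimepZr ?coprimep1.
have f10 : f1.[0] = 0.
  rewrite horner_sum big1 // => i _.
  by rewrite hornerZ hornerXn expr0n gtn_eqF // mulr0.
have f1j : f1`_(q ^ (j - l)) = b j.
  have jD : (j - l < D.+1)%N by rewrite ltnS leq_sub2r.
  rewrite coef_sum (bigD1 (Ordinal jD)) //= coefZ coefXn eqxx mulr1 subnK 1?ltnW //.
  rewrite big1 ?addr0 // => i /negPf ij.
  by rewrite coefZ coefXn eqn_exp2l // eq_sym -[(_ == _)]/(i == Ordinal jD) ij mulr0.
have sf1 : (q ^ (j - l) < size f1)%N.
  by rewrite ltnNge; apply: contra bj => /leq_sizeP/(_ _ (leqnn _)); rewrite f1j => ->.
have sf3 : (3 <= size f1)%N.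
  apply: leq_trans sf1; rewrite ltnS; apply: (leq_trans q2).
  by rewrite -{1}(expn1 q) leq_exp2l ?subn_gt0.
have sfD : ((size f1).-1 <= q ^ D)%N.
  rewrite -subn1 leq_subLR add1n; apply: leq_trans (size_sum _ _ _) _.
  apply/bigmax_leqP => i _; apply: leq_trans (size_scale_leq _ _) _.
  by rewrite size_polyXn ltnS leq_exp2l // -ltnS.
pose s := gcdn (q ^ k).-1 #|F|.-1.
have qk2 : (2 <= q ^ k)%N by apply: (leq_trans q2); rewrite -{1}(expn1 q) leq_exp2l.
have qk0 : (0 < (q ^ k).-1)%N by rewrite -ltnS prednK.
have s0 : (0 < s)%N by rewrite gcdn_gt0 qk0.
have sk : (s.+1 <= q ^ k)%N.
  by rewrite -[X in (_ <= X)%N](prednK (qgt0 k)) ltnS dvdn_leq // dvdn_gcdl.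
have [] := @kummer_point F f1 alpha (q ^ (h - l)) s _ _ s0 _ Halpha sep f10 sf3.
- by exists p; rewrite // QE pnatX pnat_id.
- rewrite HF; apply: (@leq_trans (2 ^ n)); last by rewrite leq_exp2r // ltnW.
  by rewrite (@leq_exp2l 2 2).
- exact: dvdn_gcdr.
(* With [s.+1 <= q ^ k] and [deg f1 <= q ^ D], the size condition becomes [2 (k + D) <= n], which is
   [Hm]. *)
- rewrite HF; apply: (@leq_trans ((q ^ k * q ^ D) ^ 2)).
    by rewrite leq_exp2r // leq_mul.
  by rewrite -expnD -expnM leq_exp2l // /D; lia.
move=> y' [y'0 fy'0 yM].
have [x x0 xw] := finField_root qk0 erefl yM.
(* Inverts the [q ^ l]-th power map, as [q ^ n]-th powers are trivial on [F]. *)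
pose y := y' ^+ (q ^ (n - l)).
have yl : y ^+ (q ^ l) = y'.
  rewrite /y -exprM -expnD subnK; last by rewrite ltnW // (ltn_trans ld).
  by rewrite -HF expf_card.
have y0 : y != 0 by rewrite expf_neq0.
set w := f1.[y'] / _ in yM xw.
have yH : y' ^+ (q ^ (h - l)) = y ^+ (q ^ h).
  by rewrite -yl -exprM -expnD subnKC // ltnW.
have fyE : f y = y ^+ (q ^ h) * (alpha * w + beta).
  have : f1.[y'] = alpha * w * y ^+ (q ^ h).
    by rewrite /w -yH; field; rewrite Halpha expf_neq0.
  by rewrite -{1}yl f1E => /eqP; rewrite subr_eq => /eqP ->; ring.
have gxE : g x = x * (alpha * w + beta).
  by rewrite /g -(prednK (qgt0 k)) exprS xw; ring.
apply/set0Pn; exists (span1 (x, g x)); rewrite inE; apply/andP; split.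
  by apply: imset_f; rewrite inE.
rewrite gxE (span1_scale _ x0 (expf_neq0 (q ^ h) y0)) -fyE.
by apply: (imset_f (fun y => span1 (y ^+ (q ^ h), f y))); rewrite inE.
Qed.
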